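(* Let $N\ge2$, $R>0$, let $g:[0,R]\to(0,\infty)$ be smooth, and let $A,B,p,q$ be positive constants with $A\neq B$, all independent of $\epsilon$. For $\epsilon>0$ let $U_\epsilon\in C^1([0,R])\cap C^\infty((0,R))$ be the unique solution of problem (N* ) described in the context, and let $$\rho_\epsilon(r)=-\frac{R^N}{N}\Big(\frac{Ae^{pU_\epsilon(r)}}{\int_0^Rs^{N-1}e^{pU_\epsilon(s)}ds}-\frac{Be^{-qU_\epsilon(r)}}{\int_0^Rs^{N-1}e^{-qU_\epsilon(s)}ds}\Big).$$ Then $\rho_\epsilon\rightharpoonup\frac{R(B-A)}{N}\delta_R$ weakly in $C([0,R];\mathbb{R})$ as $\epsilon\downarrow0$, and: (I) If $0<A<B$: $(\epsilon U_\epsilon')^2\rightharpoonup\frac{2R(B-A)}{qNg(R)}\delta_R$ and $e^{-qU_\epsilon}-1\rightharpoonup\frac{R(B-A)}{AN}\delta_R$ weakly in $C([0,R];\mathbb{R})$, and $e^{pU_\epsilon}-1\to0$ strongly in $L^\theta((0,R))$ for every $\theta>0$. (II) If $A>B>0$: $(\epsilon U_\epsilon')^2\rightharpoonup\frac{2R(A-B)}{pNg(R)}\delta_R$ and $e^{pU_\epsilon}-1\rightharpoonup\frac{R(A-B)}{BN}\delta_R$ weakly in $C([0,R];\mathbb{R})$, and $e^{-qU_\epsilon}-1\to0$ strongly in $L^\theta((0,R))$ for every $\theta>0$. (III) For every $\widetilde\theta\in(0,2)$, $\epsilon U_\epsilon'\to0$ strongly in $L^{\widetilde\theta}((0,R))$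 as $\epsilon\downarrow0$; more precisely there is a constant $C_{\widetilde\theta}>0$ independent of $\epsilon$ such that for all sufficiently small $\epsilon>0$, $$\|\epsilon U_\epsilon'\|_{L^{\widetilde\theta}((0,R))}\le C_{\widetilde\theta}\,\epsilon^{\min\{1,\frac{2}{\widetilde\theta}-1\}}\Big(\log\frac1\epsilon\Big)^{\chi(\widetilde\theta)},$$ where $\chi(\widetilde\theta)=1$ if $\widetilde\theta\in(0,1]$ and $\chi(\widetilde\theta)=0$ if $\widetilde\theta\in(1,2)$.
   Context: Problem (N* ): for $\epsilon>0$, find $U_\epsilon\in C^1([0,R])\cap C^\infty((0,R))$ such that for $r\in(0,R)$ $$\epsilon^2 g(r)\Big[U_\epsilon''(r)+\Big(\frac{N-1}{r}+\frac{g'(r)}{g(r)}\Big)U_\epsilon'(r)\Big]=\frac{R^N}{N}\Big(\frac{Ae^{pU_\epsilon(r)}}{\int_0^R s^{N-1}e^{pU_\epsilon(s)}ds}-\frac{Be^{-qU_\epsilon(r)}}{\int_0^R s^{N-1}e^{-qU_\epsilon(s)}ds}\Big),$$ together with $\int_0^R s^{N-1}U_\epsilon(s)\,ds=0$, $U_\epsilon'(0)=0$ and $U_\epsilon'(R)=\frac{R(A-B)}{\epsilon^2Ng(R)}$; it has a unique solution. Weak convergence to a Dirac mass: for functions $f_\epsilon$ on $[0,R]$ and a constant $\mathcal{C}\neq0$, ''$f_\epsilon\rightharpoonup\mathcal{C}\delta_R$ weakly in $C([0,R];\mathbb{R})$'' means $\lim_{\epsilon\downarrow0}\int_0^Rh(r)f_\epsilon(r)\,dr=\mathcal{C}h(R)$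 for every continuous $h:[0,R]\to\mathbb{R}$ independent of $\epsilon$. *)

(* Defs.v *)
From Stdlib Require Import Reals Lra.
From Coquelicot Require Import Coquelicot.
Open Scope R_scope.

Definition Icc (a b : R) (y : R) : Prop := a <= y <= b.

Definition cont_on_Icc (f : R -> R) (a b : R) : Prop :=
  forall x, Icc a b x ->
    filterlim f (within (Icc a b) (locally x)) (locally (f x)).

Definition deriv_on_Icc (f f' : R -> R) (a b : R) : Prop :=
  forall x, Icc a b x ->
    filterlim (fun y => (f y - f x) / (y - x))
      (within (fun y => Icc a b y /\ y <> x) (locally x)) (locally (f' x)).

Definition C1_Icc (f f' : R -> R) (a b : R) : Prop :=
  deriv_on_Icc f f' a b /\ cont_on_Icc f' a b.

Definition Cinf_Ioo (f : R -> R) (a b : R) : Prop :=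
  forall (n : nat) x, a < x < b -> ex_derive_n f n x.

(* g is smooth on [a,b] (all derivatives exist at every point of [a,b],
   i.e. g is the restriction of a function smooth near [a,b]). *)
Definition Cinf_Icc (f : R -> R) (a b : R) : Prop :=
  forall (n : nat) x, a <= x <= b -> ex_derive_n f n x.

(* Nonnegative-base real power x^t, with 0^t = 0 (for t > 0). *)
Definition powp (x t : R) : R := if Rle_dec x 0 then 0 else Rpower x t.

Definition Lnorm (f : R -> R) (a b theta : R) : R :=
  powp (RInt (fun r => powp (Rabs (f r)) theta) a b) (/ theta).

Definition weak_dirac (f : R -> R -> R) (Rad C : R) : Prop :=
  forall h : R -> R, cont_on_Icc h 0 Rad ->
    filterlim (fun eps => RInt (fun r => h r * f eps r) 0 Rad)
      (at_right 0) (locally (C * h Rad)).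

Definition Lconv0 (f : R -> R -> R) (Rad theta : R) : Prop :=
  filterlim (fun eps => Lnorm (f eps) 0 Rad theta) (at_right 0) (locally 0).

Definition Iplus (N : nat) (Rad p : R) (u : R -> R) : R :=
  RInt (fun s => s ^ (N - 1) * exp (p * u s)) 0 Rad.
Definition Iminus (N : nat) (Rad q : R) (u : R -> R) : R :=
  RInt (fun s => s ^ (N - 1) * exp (- q * u s)) 0 Rad.

Definition rhsN (N : nat) (Rad A B p q : R) (u : R -> R) (r : R) : R :=
  Rad ^ N / INR N *
  (A * exp (p * u r) / Iplus N Rad p u - B * exp (- q * u r) / Iminus N Rad q u).

Definition solves_Nstar (N : nat) (Rad : R) (g : R -> R) (A B p q eps : R)
  (u u' : R -> R) : Prop :=
  C1_Icc u u' 0 Rad /\ Cinf_Ioo u 0 Rad /\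
  (forall r, 0 < r < Rad ->
     eps ^ 2 * g r *
       (Derive_n u 2 r + ((INR N - 1) / r + Derive g r / g r) * u' r)
     = rhsN N Rad A B p q u r) /\
  RInt (fun s => s ^ (N - 1) * u s) 0 Rad = 0 /\
  u' 0 = 0 /\
  u' Rad = Rad * (A - B) / (eps ^ 2 * INR N * g Rad).

Definition rho (N : nat) (Rad A B p q : R) (u : R -> R) (r : R) : R :=
  - rhsN N Rad A B p q u r.

(* Main.v *)
(** Write [n = N - 1], [F u = a e^(pu) - b e^(-qu)] with [a], [b] absorbing the
    nonlocal denominators, and [v = r^n g u'].  The equation is
    [eps^2 v' = r^n F u], and [u -> -u] exchanges [(A, p)] and [(B, q)], so
    assume [A > B].  Then [v >= 0], hence [u] and [F u] are nondecreasing, and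
    [F (u 0) >= 0] with Jensen's inequality bounds [u] from below and keeps
    [a], [b] in compact subsets of [(0, oo)].  The identity
    [(eps^2 v^2 / 2)' = r^(2n) g (G u)'], where [G' = F], gives
    [eps u' <= C e^(pu/2)] and [e^(p u(R)) <= C / eps^2]; integrating
    [(eps u')^theta <= C eps e^(p (theta-1) u / 2) u'] yields the rates in (III).

    Since [F u] is nondecreasing with fixed mass [int r^n F u], [u] is bounded
    on [[0, r0]] for [r0 < R], so there [eps^2 v = O(eps)] and [F u = O(eps)]:
    the mass concentrates at [R].  The zero mean of [u] then forces [u -> 0]
    locally uniformly and [a, b -> B], which gives the limits of the two
    exponentials; the energy identity compares [(eps u')^2] with
    [2 (G u - G (u 0)) / g]. *)

Require Import Defs.
From Stdlib Require Import Reals Lra Lia.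
From Coquelicot Require Import Coquelicot.
Open Scope R_scope.

(** No boundary-layer profile is constructed. A nonnegative family with bounded integral that is
    small on every [[0, r0]] with [r0 < Rad] can only concentrate at [Rad], so its limit is fixed by
    a single test function that does not vanish there. For [F u] this function is [r ^ n], against
    which the integral is prescribed exactly by the normalisation of [a] and [b]; for [(e u')^2] it
    is the weight that turns the integrand into twice the energy density. The obstacle is that [a]
    is defined through the integral of the very exponential that concentrates, so its limit cannot
    be read off from its definition, and it is not [A]. It is found at the centre instead: [b] tends
    to [B] by bounded convergence, and [u 0] and [F (u 0)] tend to 0, which forces [a] to tend to
    [B]. The convergence of [u 0] rests on uniform integrability: [u - u 0] is at most a constant
    plus an arbitrarily small multiple of [exp (p u)], whose integral stays bounded. *)

Definition cts (f : R -> R) : Prop := forall x, continuous f x.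

(** * Calculus of everywhere continuous functions *)

Lemma cts_const (c : R) : cts (fun _ => c).
Proof. intro x; apply continuous_const. Qed.

Lemma cts_id : cts (fun x => x).
Proof. intro x; apply continuous_id. Qed.

Lemma cts_plus (f h : R -> R) : cts f -> cts h -> cts (fun x => f x + h x).
Proof. intros Hf Hh x; apply (continuous_plus f h x); auto. Qed.

Lemma cts_opp (f : R -> R) : cts f -> cts (fun x => - f x).
Proof. intros Hf x; apply (continuous_opp f x); auto. Qed.

Lemma cts_minus (f h : R -> R) : cts f -> cts h -> cts (fun x => f x - h x).
Proof. intros Hf Hh x; apply (continuous_minus f h x); auto. Qed.

Lemma cts_mult (f h : R -> R) : cts f -> cts h -> cts (fun x => f x * h x).
Proof. intros Hf Hh x; apply (continuous_mult f h x); auto. Qed.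

Lemma cts_comp (f h : R -> R) : cts f -> cts h -> cts (fun x => h (f x)).
Proof. intros Hf Hh x; apply continuous_comp; auto. Qed.

Lemma cts_exp (f : R -> R) : cts f -> cts (fun x => exp (f x)).
Proof. intros Hf x; apply continuous_exp_comp; auto. Qed.

Lemma cts_abs (f : R -> R) : cts f -> cts (fun x => Rabs (f x)).
Proof. intros Hf x; apply continuous_Rabs_comp; auto. Qed.

Lemma cts_pow (f : R -> R) (n : nat) : cts f -> cts (fun x => f x ^ n).
Proof.
intros Hf; induction n as [|n IH]; simpl.
- apply cts_const.
- now apply cts_mult.
Qed.

Ltac cts :=
  unfold Rdiv;
  repeat match goal with
  | |- cts (fun _ => ?c) => apply cts_const
  | |- cts (fun x => x) => apply cts_id
  | |- cts (fun x => @?f x + @?h x) => apply (cts_plus f h)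
  | |- cts (fun x => @?f x - @?h x) => apply (cts_minus f h)
  | |- cts (fun x => @?f x * @?h x) => apply (cts_mult f h)
  | |- cts (fun x => - @?f x) => apply (cts_opp f)
  | |- cts (fun x => exp (@?f x)) => apply (cts_exp f)
  | |- cts (fun x => Rabs (@?f x)) => apply (cts_abs f)
  | |- cts (fun x => (@?f x) ^ ?n) => apply (cts_pow f n)
  | _ => assumption
  end.

Lemma cts_RInt (f : R -> R) (a b : R) : cts f -> ex_RInt f a b.
Proof. intros Hf; apply (ex_RInt_continuous f); auto. Qed.

Lemma RInt_cts_plus (f h : R -> R) (a b : R) : cts f -> cts h ->
  RInt (fun x => f x + h x) a b = RInt f a b + RInt h a b.
Proof. intros; apply (RInt_plus f h); now apply cts_RInt. Qed.

Lemma RInt_cts_scal (f : R -> R) (c a b : R) : cts f ->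
  RInt (fun x => c * f x) a b = c * RInt f a b.
Proof. intros; apply (RInt_scal f); now apply cts_RInt. Qed.

Lemma RInt_cts_le (f h : R -> R) (a b : R) : a <= b -> cts f -> cts h ->
  (forall x, a < x < b -> f x <= h x) -> RInt f a b <= RInt h a b.
Proof. intros; apply RInt_le; auto; now apply cts_RInt. Qed.

Lemma RInt_cts_split (f : R -> R) (a b c : R) : cts f ->
  RInt f a c = RInt f a b + RInt f b c.
Proof.
intros Hf; symmetry; apply (RInt_Chasles f a b c); now apply cts_RInt.
Qed.

Lemma RInt_cts_const (c a b : R) : RInt (fun _ => c) a b = c * (b - a).
Proof. rewrite RInt_const; unfold scal; simpl; unfold mult; simpl; ring. Qed.

Lemma RInt_cts_abs (f : R -> R) (a b : R) : a <= b -> cts f ->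
  Rabs (RInt f a b) <= RInt (fun x => Rabs (f x)) a b.
Proof. intros; apply abs_RInt_le; auto; now apply cts_RInt. Qed.

Lemma derive_nonneg_le (f : R -> R) (a b : R) : a <= b -> cts f ->
  (forall x, a < x < b -> exists l, is_derive f x l /\ 0 <= l) -> f a <= f b.
Proof.
intros Hab Hf Hd.
(* The intermediate point of [MVT_gen] may be an endpoint, where [f] need not be differentiable; the
   default value 0 there keeps the sign of [df c]. *)
set (df := fun x => if Rlt_dec a x then
                     if Rlt_dec x b then Derive f x else 0 else 0).
destruct (MVT_gen f a b df) as [c [Hc E]].
- rewrite Rmin_left, Rmax_right by lra; intros x Hx.
  unfold df; destruct Rlt_dec; [|lra]; destruct Rlt_dec; [|lra].
  destruct (Hd x Hx) as [l [Hl _]]; apply Derive_correct; now exists l.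
- intros x _; apply continuity_pt_filterlim, Hf.
- assert (Hpos : 0 <= df c).
  { unfold df; destruct Rlt_dec; [|lra]; destruct Rlt_dec; [|lra].
    destruct (Hd c ltac:(lra)) as [l [Hl Hl0]].
    now rewrite (is_derive_unique f c l Hl). }
  nra.
Qed.

Lemma RInt_cts_derive (f : R -> R) (a x : R) : cts f ->
  is_derive (fun y => RInt f a y) x (f x).
Proof.
intros Hf; apply (is_derive_RInt f (fun y => RInt f a y) a x); auto.
apply filter_forall; intros y; apply (RInt_correct f); now apply cts_RInt.
Qed.

(** [P] minus the integral of [f] is nondecreasing. A derivative is asked for only inside the
    interval, because clamped functions may have corners at its ends. *)
Lemma RInt_le_primitive (f P : R -> R) (a b : R) : a <= b -> cts f -> cts P ->
  (forall x, a < x < b -> exists l, is_derive P x l /\ f x <= l) ->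
  RInt f a b <= P b - P a.
Proof.
intros Hab Hf HP Hd.
assert (H : P a - RInt f a a <= P b - RInt f a b).
{ apply (derive_nonneg_le (fun x => P x - RInt f a x)); auto.
  - intros x; apply (continuous_minus P (fun y => RInt f a y)); auto.
    apply (@ex_derive_continuous R_AbsRing R_NormedModule).
    eexists; now apply RInt_cts_derive.
  - intros x Hx; destruct (Hd x Hx) as [l [Hl Hle]].
    exists (l - f x); split; [|lra].
    apply (is_derive_minus P (fun y => RInt f a y)); auto.
    now apply RInt_cts_derive. }
rewrite (RInt_point (V := R_CompleteNormedModule)) in H.
unfold zero in H; simpl in H; lra.
Qed.

Lemma RInt_pow0 (n : nat) (b : R) :
  RInt (fun x => x ^ n) 0 b = b ^ (S n) / INR (S n).
Proof.
assert (Hn : INR (S n) <> 0) by (apply not_0_INR; lia).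
replace (b ^ S n / INR (S n))
  with (b ^ S n / INR (S n) - 0 ^ S n / INR (S n)).
2: { rewrite (pow_i (S n)) by lia. field; auto. }
apply is_RInt_unique.
apply (is_RInt_derive (fun x => x ^ S n / INR (S n)) (fun x => x ^ n)).
- intros x _; auto_derive; auto. simpl pred.
  change (match n with 0%nat => 1 | S _ => INR n + 1 end) with (INR (S n)).
  field; auto.
- intros x _; apply (cts_pow (fun x => x)), cts_id.
Qed.

Lemma cts_bounded (f : R -> R) (a b : R) : a <= b -> cts f ->
  exists K, 0 < K /\ forall x, a <= x <= b -> Rabs (f x) <= K.
Proof.
intros Hab Hf.
destruct (continuity_ab_maj (fun x => Rabs (f x)) a b Hab) as [m [Hm _]].
{ intros c _; apply continuity_pt_filterlim, (cts_abs f Hf). }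
exists (Rabs (f m) + 1); split.
- pose proof (Rabs_pos (f m)); lra.
- intros x Hx; specialize (Hm x Hx); lra.
Qed.

Lemma cts_left_close (f : R -> R) (b eta : R) : cts f -> 0 < eta ->
  exists d, 0 < d /\ forall x, b - d <= x <= b -> Rabs (f x - f b) <= eta.
Proof.
intros Hf He.
destruct (proj1 (filterlim_locally f (f b)) (Hf b) (mkposreal eta He)) as [d Hd].
exists (d / 2); split; [pose proof (cond_pos d); lra|].
intros x Hx; left; apply Hd.
unfold ball; simpl; unfold AbsRing_ball, abs, minus, plus, opp; simpl.
pose proof (cond_pos d); apply Rabs_def1; lra.
Qed.

Lemma exp_le (x y : R) : x <= y -> exp x <= exp y.
Proof. intros [H| ->]; [left; now apply exp_increasing|lra]. Qed.

(** * Extension from an interval to the line *)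

(** The retraction of the line onto [[0, b]]. Composing with it makes a function given on the
    interval continuous everywhere, so that integrability never depends on the domain. *)
Definition clamp (b x : R) : R := Rmax 0 (Rmin x b).

Lemma clamp_in (b x : R) : 0 <= b -> 0 <= clamp b x <= b.
Proof. intros; unfold clamp, Rmax, Rmin; repeat destruct Rle_dec; lra. Qed.

Lemma clamp_id (b x : R) : 0 <= x <= b -> clamp b x = x.
Proof. intros; unfold clamp, Rmax, Rmin; repeat destruct Rle_dec; lra. Qed.

(** The clamp is 1-Lipschitz with values in [[0, b]], hence sends small balls around [x] into the
    filter [within (Icc 0 b)] at its image. *)
Lemma cont_clamp (f : R -> R) (b : R) : 0 <= b -> cont_on_Icc f 0 b ->
  cts (fun x => f (clamp b x)).
Proof.
intros Hb Hf x.
apply filterlim_comp with (G := within (Icc 0 b) (locally (clamp b x))).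
2: apply Hf, clamp_in, Hb.
intros P [d HP].
exists d; intros y Hy.
apply HP; [|apply clamp_in, Hb].
revert Hy; unfold ball; simpl; unfold AbsRing_ball, abs, minus, plus, opp; simpl.
intros Hy; apply Rle_lt_trans with (2 := Hy).
unfold clamp, Rmax, Rmin; repeat destruct Rle_dec;
  unfold Rabs; repeat destruct Rcase_abs; lra.
Qed.

Lemma locally_between (a b x : R) : a < x < b -> locally x (fun y => a < y < b).
Proof.
intros H.
assert (Hd : 0 < Rmin (x - a) (b - x)) by (apply Rmin_glb_lt; lra).
exists (mkposreal _ Hd); intros y; unfold ball; simpl;
  unfold AbsRing_ball, abs, minus, plus, opp; simpl; intros Hy.
apply Rabs_def2 in Hy.
pose proof (Rmin_l (x - a) (b - x)); pose proof (Rmin_r (x - a) (b - x)); lra.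
Qed.

Lemma is_derive_clamp (f : R -> R) (b x l : R) : 0 < x < b ->
  is_derive f x l -> is_derive (fun y => f (clamp b y)) x l.
Proof.
intros Hx; apply is_derive_ext_loc.
apply filter_imp with (2 := locally_between 0 b x Hx).
intros y Hy; rewrite clamp_id; auto; lra.
Qed.

Lemma deriv_Icc_is_derive (f f' : R -> R) (a b x : R) :
  deriv_on_Icc f f' a b -> a < x < b -> is_derive f x (f' x).
Proof.
intros Hd Hx; apply is_derive_Reals; intros e He.
assert (Hx' : Icc a b x) by (unfold Icc; lra).
specialize (Hd x Hx').
destruct (proj1 (filterlim_locally _ _) Hd (mkposreal e He)) as [d Hd'].
destruct (locally_between a b x Hx) as [d2 Hd2].
assert (Hm : 0 < Rmin d d2) by (apply Rmin_glb_lt; apply cond_pos).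
exists (mkposreal _ Hm); intros h Hh Hlt; simpl in Hlt.
pose proof (Rmin_l d d2); pose proof (Rmin_r d d2).
assert (B : forall r : posreal, Rabs h < r -> ball x r (x + h)).
{ intros r Hr; unfold ball; simpl;
    unfold AbsRing_ball, abs, minus, plus, opp; simpl.
  replace (x + h + - x) with h by ring; auto. }
specialize (Hd' (x + h) (B d ltac:(lra))).
specialize (Hd2 (x + h) (B d2 ltac:(lra))).
assert (K := Hd' ltac:(unfold Icc; split; lra)).
unfold ball in K; simpl in K;
  unfold AbsRing_ball, abs, minus, plus, opp in K; simpl in K.
replace (x + h - x) with h in K by ring. exact K.
Qed.

(** Near [x] the difference quotient is at most [Rabs (f' x) + 1] in absolute value, which serves as
    a Lipschitz constant at [x], endpoints included. *)
Lemma deriv_Icc_cont (f f' : R -> R) (a b : R) :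
  deriv_on_Icc f f' a b -> cont_on_Icc f a b.
Proof.
intros Hd x Hx; apply filterlim_locally; intros e.
destruct (proj1 (filterlim_locally _ _) (Hd x Hx) (mkposreal 1 Rlt_0_1))
  as [d Hd'].
assert (Hk : 0 < Rabs (f' x) + 1) by (pose proof (Rabs_pos (f' x)); lra).
assert (Hm : 0 < Rmin d (e / (Rabs (f' x) + 1))).
{ apply Rmin_glb_lt; [apply cond_pos|].
  apply Rdiv_lt_0_compat; auto; apply cond_pos. }
exists (mkposreal _ Hm); intros y Hy Iy.
pose proof (Rmin_l d (e / (Rabs (f' x) + 1)));
  pose proof (Rmin_r d (e / (Rabs (f' x) + 1))).
unfold ball in Hy |- *; simpl in Hy |- *;
  unfold AbsRing_ball, abs, minus, plus, opp in Hy |- *; simpl in Hy |- *.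
destruct (Req_dec y x) as [->|Hne].
{ replace (f x + - f x) with 0 by ring; rewrite Rabs_R0; apply cond_pos. }
assert (K := Hd' y ltac:(unfold ball; simpl;
    unfold AbsRing_ball, abs, minus, plus, opp; simpl; lra) ltac:(auto)).
unfold ball in K; simpl in K;
  unfold AbsRing_ball, abs, minus, plus, opp in K; simpl in K.
assert (Hq : Rabs ((f y - f x) / (y - x)) < Rabs (f' x) + 1).
{ replace ((f y - f x) / (y - x))
    with (f' x + ((f y - f x) / (y - x) + - f' x)) by ring.
  eapply Rle_lt_trans; [apply Rabs_triang|lra]. }
replace (f y + - f x) with ((f y - f x) / (y - x) * (y + - x))
  by (field; lra).
rewrite Rabs_mult.
apply Rle_lt_trans with ((Rabs (f' x) + 1) * Rabs (y + - x)).
- apply Rmult_le_compat_r; [apply Rabs_pos|lra].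
- apply Rlt_le_trans with ((Rabs (f' x) + 1) * (e / (Rabs (f' x) + 1))).
  + apply Rmult_lt_compat_l; lra.
  + right; field; lra.
Qed.

(** * Real powers, and strict monotonicity *)

Lemma powp_nonneg (x t : R) : 0 <= powp x t.
Proof. unfold powp; destruct Rle_dec; [lra|left; apply exp_pos]. Qed.

Lemma powp_0 (t : R) : powp 0 t = 0.
Proof. unfold powp; destruct Rle_dec; lra. Qed.

Lemma powp_pos (x t : R) : 0 < x -> powp x t = Rpower x t.
Proof. intros; unfold powp; destruct Rle_dec; lra. Qed.

Lemma powp_le (x y t : R) : 0 < t -> x <= y -> powp x t <= powp y t.
Proof.
intros Ht Hxy; unfold powp; repeat destruct Rle_dec; try lra.
- left; apply exp_pos.
- apply Rle_Rpower_l; lra.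
Qed.

Lemma powp_small (t eta : R) : 0 < t -> 0 < eta ->
  0 < Rpower eta (/ t) /\ powp (Rpower eta (/ t)) t = eta.
Proof.
intros Ht He; split; [apply exp_pos|].
rewrite powp_pos by apply exp_pos.
rewrite Rpower_mult, Rinv_l by lra; now apply Rpower_1.
Qed.

(** At a point [x <= 0] the radius is the [t]-th root of half the tolerance; at [x > 0] the power
    agrees nearby with [exp (t * ln y)]. *)
Lemma cts_powp (t : R) : 0 < t -> cts (fun x => powp x t).
Proof.
intros Ht x.
destruct (Rle_lt_dec x 0) as [Hx|Hx].
- apply filterlim_locally; intros e.
  destruct (powp_small t (e / 2) Ht) as [Hp E];
    [pose proof (cond_pos e); lra|].
  exists (mkposreal _ Hp); intros y.
  unfold ball; simpl; unfold AbsRing_ball, abs, minus, plus, opp; simpl.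
  intros Hy; apply Rabs_def2 in Hy.
  replace (powp x t) with 0 by (unfold powp; destruct Rle_dec; lra).
  pose proof (powp_nonneg y t).
  assert (powp y t <= e / 2) by (rewrite <- E; apply powp_le; lra).
  pose proof (cond_pos e); rewrite Rabs_pos_eq; lra.
- apply continuous_ext_loc with (fun y => exp (t * ln y)).
  + apply filter_imp with (2 := locally_between 0 (x + 1) x ltac:(lra)).
    intros y Hy; rewrite powp_pos; [reflexivity|lra].
  + apply (@ex_derive_continuous R_AbsRing R_NormedModule).
    auto_derive; lra.
Qed.

Lemma cts_powp_abs (f : R -> R) (t : R) : 0 < t -> cts f ->
  cts (fun x => powp (Rabs (f x)) t).
Proof.
intros Ht Hf; apply (cts_comp _ _ (cts_abs f Hf) (cts_powp t Ht)).
Qed.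

Lemma derive_pos_lt (f : R -> R) (a b : R) : a < b -> cts f ->
  (forall x, a < x < b -> exists l, is_derive f x l /\ 0 < l) -> f a < f b.
Proof.
intros Hab Hf Hd.
(* The default is now 1, so that an intermediate point at an endpoint still gives a strict sign. *)
set (df := fun x => if Rlt_dec a x then
                     if Rlt_dec x b then Derive f x else 1 else 1).
destruct (MVT_gen f a b df) as [c [Hc E]].
- rewrite Rmin_left, Rmax_right by lra; intros x Hx.
  unfold df; destruct Rlt_dec; [|lra]; destruct Rlt_dec; [|lra].
  destruct (Hd x Hx) as [l [Hl _]]; apply Derive_correct; now exists l.
- intros x _; apply continuity_pt_filterlim, Hf.
- assert (Hpos : 0 < df c).
  { unfold df; destruct Rlt_dec; [|lra]; destruct Rlt_dec; [|lra].
    destruct (Hd c ltac:(lra)) as [l [Hl Hl0]].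
    now rewrite (is_derive_unique f c l Hl). }
  nra.
Qed.

Lemma cts_right_neg (f : R -> R) (x c : R) : cts f -> f x < 0 -> x < c ->
  exists d, 0 < d /\ x + d < c /\ forall y, x <= y <= x + d -> f y < 0.
Proof.
intros Hf Hx Hc.
destruct (proj1 (filterlim_locally f (f x)) (Hf x) (mkposreal (- f x) ltac:(lra)))
  as [d Hd].
pose proof (cond_pos d) as Hp.
pose proof (Rmin_l (d / 2) ((c - x) / 2)); pose proof (Rmin_r (d / 2) ((c - x) / 2)).
exists (Rmin (d / 2) ((c - x) / 2)); split; [apply Rmin_glb_lt; lra|].
split; [lra|]; intros y Hy.
assert (K : ball x d y).
{ unfold ball; simpl; unfold AbsRing_ball, abs, minus, plus, opp; simpl.
  apply Rabs_def1; lra. }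
apply Hd in K; unfold ball in K; simpl in K;
  unfold AbsRing_ball, abs, minus, plus, opp in K; simpl in K.
apply Rabs_def2 in K; lra.
Qed.

(* Multiplied by [r^(N-1)], with [N = n + 1], the equation has the divergence form
   [(r^n g u')' = r^n (a e^(pu) - b e^(-qu)) / e^2], where [a] and [b] absorb
   the nonlocal denominators. *)
Record sol (n : nat) (Rad : R) (g : R -> R) (A B p q e : R)
  (u du : R -> R) (a b : R) : Prop := mkSol {
  sol_cts : cts u;
  sol_cts' : cts du;
  sol_deriv : forall x, 0 < x < Rad -> is_derive u x (du x);
  sol_eq : forall x, 0 < x < Rad ->
    is_derive (fun r => r ^ n * g r * du r) x
      (x ^ n * (a * exp (p * u x) - b * exp (- q * u x)) / e ^ 2);
  sol_left : du 0 = 0;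
  sol_right : du Rad = Rad * (A - B) / (e ^ 2 * INR (S n) * g Rad);
  sol_mean : RInt (fun s => s ^ n * u s) 0 Rad = 0;
  sol_a : a * RInt (fun s => s ^ n * exp (p * u s)) 0 Rad
          = Rad ^ S n / INR (S n) * A;
  sol_b : b * RInt (fun s => s ^ n * exp (- q * u s)) 0 Rad
          = Rad ^ S n / INR (S n) * B }.

(** The bounds [gm], [gM] hold on the whole line because [g] enters through its clamped version;
    they are parameters so that later constants depend on them and not on [e]. The case [A < B]
    comes back to this one by [sol_opp]. *)
Record data (Rad : R) (g : R -> R) (gm gM A B p q : R) : Prop := mkData {
  data_R : 0 < Rad;
  data_g : cts g;
  data_gm : 0 < gm;
  data_gb : forall x, gm <= g x <= gM;
  data_B : 0 < B;
  data_A : B < A;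
  data_p : 0 < p;
  data_q : 0 < q }.

(** Jensen's inequality in the tangent form [exp y >= 1 + y], whose linear term integrates to zero.
    The sign of [c] is free, so both [p] and [- q] are covered. *)
Lemma mean_exp_ge (n : nat) (Rad c : R) (u : R -> R) : 0 <= Rad -> cts u ->
  RInt (fun s => s ^ n * u s) 0 Rad = 0 ->
  Rad ^ S n / INR (S n) <= RInt (fun s => s ^ n * exp (c * u s)) 0 Rad.
Proof.
intros HR Hu H0.
rewrite <- RInt_pow0.
replace (RInt (fun x => x ^ n) 0 Rad)
  with (RInt (fun s => s ^ n + c * (s ^ n * u s)) 0 Rad).
- apply RInt_cts_le; auto; try cts.
  intros x Hx.
  assert (0 <= x ^ n) by (apply pow_le; lra).
  pose proof (exp_ineq1_le (c * u x)); nra.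
- rewrite RInt_cts_plus by cts.
  rewrite RInt_cts_scal, H0, Rmult_0_r, Rplus_0_r by cts; reflexivity.
Qed.

Lemma opp_frac_pos (x y z : R) : 0 < x -> y < 0 -> 0 < z -> 0 < - (x * y / z).
Proof.
intros Hx Hy Hz; replace (- (x * y / z)) with (x * - y * / z) by (field; lra).
repeat apply Rmult_lt_0_compat; try lra; now apply Rinv_0_lt_compat.
Qed.

(** * Estimates for one solution, with constants free of [e], when [B < A] *)

Section Estimates.

Context (n : nat) (Rad : R) (g : R -> R) (gm gM A B p q e : R)
  (u du : R -> R) (a b : R).
Hypothesis HD : data Rad g gm gM A B p q.
Hypothesis He : 0 < e.
Hypothesis HS : sol n Rad g A B p q e u du a b.

Let Vol := Rad ^ S n / INR (S n).
Let v := fun r => r ^ n * g r * du r.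
Let F := fun y => a * exp (p * y) - b * exp (- q * y).
Let G := fun y => a / p * exp (p * y) + b / q * exp (- q * y).

Let HR := data_R _ _ _ _ _ _ _ _ HD.
Let Hg := data_g _ _ _ _ _ _ _ _ HD.
Let Hgm := data_gm _ _ _ _ _ _ _ _ HD.
Let Hgb := data_gb _ _ _ _ _ _ _ _ HD.
Let HB := data_B _ _ _ _ _ _ _ _ HD.
Let HA := data_A _ _ _ _ _ _ _ _ HD.
Let Hp := data_p _ _ _ _ _ _ _ _ HD.
Let Hq := data_q _ _ _ _ _ _ _ _ HD.
Let Hu := sol_cts _ _ _ _ _ _ _ _ _ _ _ _ HS.
Let Hdu := sol_cts' _ _ _ _ _ _ _ _ _ _ _ _ HS.
Let Du := sol_deriv _ _ _ _ _ _ _ _ _ _ _ _ HS.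
Let Dv := sol_eq _ _ _ _ _ _ _ _ _ _ _ _ HS.
Let Hmean := sol_mean _ _ _ _ _ _ _ _ _ _ _ _ HS.

Lemma vol_pos : 0 < Vol.
Proof.
apply Rdiv_lt_0_compat; [now apply pow_lt|apply lt_0_INR; lia].
Qed.

Lemma g_pos x : 0 < g x.
Proof. specialize (Hgb x); lra. Qed.

Lemma sol_v_cts : cts v.
Proof. unfold v; cts. Qed.

Lemma sol_F_cts : cts (fun x => F (u x)).
Proof. unfold F; cts. Qed.

(** The normalisation [E] fixes the product of [a] and the exponential integral as [Vol * A], and by
    [J] that integral is at least [Vol]. The bounds on [b] arise in the same way. *)
Lemma sol_a_bounds : 0 < a <= A.
Proof.
pose proof vol_pos.
pose proof (sol_a _ _ _ _ _ _ _ _ _ _ _ _ HS) as E.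
pose proof (mean_exp_ge n Rad p u ltac:(lra) Hu Hmean) as J.
fold Vol in E, J.
split.
- apply Rmult_lt_reg_r with (RInt (fun s => s ^ n * exp (p * u s)) 0 Rad); nra.
- apply Rmult_le_reg_r with Vol; auto.
  apply Rnot_lt_le; intros K.
  assert (0 < a) by nra. nra.
Qed.

Lemma sol_b_bounds : 0 < b <= B.
Proof.
pose proof vol_pos.
pose proof (sol_b _ _ _ _ _ _ _ _ _ _ _ _ HS) as E.
pose proof (mean_exp_ge n Rad (- q) u ltac:(lra) Hu Hmean) as J.
fold Vol in E, J.
split.
- apply Rmult_lt_reg_r with (RInt (fun s => s ^ n * exp (- q * u s)) 0 Rad); nra.
- apply Rmult_le_reg_r with Vol; auto.
  apply Rnot_lt_le; intros K.
  assert (0 < b) by nra. nra.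
Qed.

Lemma F_increasing x y : x < y -> F x < F y.
Proof.
intros H; pose proof sol_a_bounds; pose proof sol_b_bounds; unfold F.
assert (exp (p * x) < exp (p * y)) by (apply exp_increasing; nra).
assert (exp (- q * y) < exp (- q * x)) by (apply exp_increasing; nra).
nra.
Qed.

Lemma F_le x y : x <= y -> F x <= F y.
Proof.
intros [H| ->]; [left; now apply F_increasing|lra].
Qed.

(** The boundary datum makes the scaled flux through [Rad] independent of [e]. It calibrates both
    the local bound on [F u] and the growth of [u Rad]. *)
Lemma flux_right : e ^ 2 * v Rad = Vol * (A - B).
Proof.
unfold v, Vol; rewrite (sol_right _ _ _ _ _ _ _ _ _ _ _ _ HS).
simpl pow; field; repeat split; try lra.
- apply not_0_INR; lia.
- pose proof (g_pos Rad); lra.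
Qed.

(* At a negative interior minimum of the flux, [F (u) = 0] and [u] decreases,
   so that the flux would decrease further to the right. *)
Lemma flux_nonneg x : 0 <= x <= Rad -> 0 <= v x.
Proof.
intros Hx.
destruct (continuity_ab_min v 0 Rad) as [m [Hm Im]]; [lra| |].
{ intros c _; apply continuity_pt_filterlim, sol_v_cts. }
apply Rle_trans with (v m); auto.
apply Rnot_lt_le; intros Neg.
assert (H0 : v 0 = 0)
  by (unfold v; rewrite (sol_left _ _ _ _ _ _ _ _ _ _ _ _ HS); ring).
assert (H1 : 0 < v Rad).
{ pose proof flux_right; pose proof vol_pos.
  assert (0 < e ^ 2) by (apply pow_lt; auto).
  apply Rmult_lt_reg_l with (e ^ 2); nra. }
assert (Im' : 0 < m < Rad).
{ split; apply Rnot_le_lt; intros K; [replace m with 0 in Neg by lra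
    |replace m with Rad in Neg by lra]; lra. }
assert (Hmn : 0 < m ^ n) by (apply pow_lt; lra).
assert (Hz : F (u m) = 0).
{ pose proof (proj1 (is_derive_Reals _ _ _) (Dv m Im')) as D.
  pose proof (deriv_minimum v 0 Rad m (exist _ _ D) ltac:(lra) ltac:(lra)
    ltac:(intros; apply Hm; lra)) as Z; simpl in Z.
  fold (F (u m)) in Z.
  assert (0 < e * (e * 1)) by nra.
  apply Rmult_integral in Z; destruct Z as [Z|Z].
  - apply Rmult_integral in Z; destruct Z; lra.
  - exfalso; revert Z; apply Rinv_neq_0_compat; lra. }
assert (Hdm : du m < 0).
{ unfold v in Neg; pose proof (g_pos m).
  assert (0 < m ^ n * g m) by nra. nra. }
destruct (cts_right_neg du m Rad Hdu Hdm ltac:(lra)) as [d [Hd [Hd' Hneg]]].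
assert (Hlt : forall y, m < y <= m + d -> u y < u m).
{ intros y Hy.
  enough (- u m < - u y) by lra.
  apply (derive_pos_lt (fun y => - u y)); [lra|cts|].
  intros z Hz'; exists (- du z); split.
  - apply (is_derive_opp u), Du; lra.
  - specialize (Hneg z ltac:(lra)); lra. }
assert (K : - v m < - v (m + d)).
{ apply (derive_pos_lt (fun y => - v y)); [lra| |].
  - pose proof sol_v_cts; cts.
  - intros z Hz'; eexists; split.
    + apply (is_derive_opp v), Dv; lra.
    + fold (F (u z)); unfold opp; simpl.
      pose proof (F_increasing _ _ (Hlt z ltac:(lra))).
      apply opp_frac_pos; [apply pow_lt; lra|lra|nra]. }
specialize (Hm (m + d) ltac:(lra)); lra.
Qed.

Lemma sol_du_nonneg x : 0 <= x <= Rad -> 0 <= du x.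
Proof.
intros Hx; destruct (Req_dec x 0) as [->|Hne].
(* At 0 the weight [x ^ n] may vanish, so the flux gives no information and the boundary condition
   decides. *)
- rewrite (sol_left _ _ _ _ _ _ _ _ _ _ _ _ HS); lra.
- pose proof (flux_nonneg x Hx) as K; unfold v in K.
  pose proof (g_pos x).
  assert (0 < x ^ n) by (apply pow_lt; lra).
  assert (0 < x ^ n * g x) by nra.
  apply Rnot_lt_le; intros L; nra.
Qed.

Lemma sol_u_mono x y : 0 <= x -> x <= y -> y <= Rad -> u x <= u y.
Proof.
intros; apply (derive_nonneg_le u); auto.
intros z Hz; exists (du z); split; [apply Du; lra|apply sol_du_nonneg; lra].
Qed.

(** Were [F (u 0)] negative, the flux would decrease strictly from its value 0 at the centre and
    become negative. *)
Lemma sol_F0 : 0 <= F (u 0).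
Proof.
apply Rnot_lt_le; intros Neg.
destruct (cts_right_neg _ 0 Rad sol_F_cts Neg HR) as [d [Hd [Hd' K]]].
rewrite Rplus_0_l in *.
pose proof (flux_nonneg d ltac:(lra)).
assert (H0 : v 0 = 0)
  by (unfold v; rewrite (sol_left _ _ _ _ _ _ _ _ _ _ _ _ HS); ring).
assert (- v 0 < - v d); [|lra].
apply (derive_pos_lt (fun y => - v y)); [lra| |].
- pose proof sol_v_cts; cts.
- intros z Hz; eexists; split.
  + apply (is_derive_opp v), Dv; lra.
  + fold (F (u z)); unfold opp; simpl.
    specialize (K z ltac:(lra)); cbv beta in K.
    apply opp_frac_pos; [apply pow_lt; lra|lra|nra].
Qed.

Lemma sol_F_nonneg x : 0 <= x <= Rad -> 0 <= F (u x).
Proof.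
intros Hx; apply Rle_trans with (1 := sol_F0), F_le, sol_u_mono; lra.
Qed.

(** Otherwise the nondecreasing [u] would stay above a positive constant, against its zero weighted
    mean. *)
Lemma sol_u0_le : u 0 <= 0.
Proof.
apply Rnot_lt_le; intros Pos.
assert (K : RInt (fun s => u 0 * s ^ n) 0 Rad <= RInt (fun s => s ^ n * u s) 0 Rad).
{ apply RInt_cts_le; try cts; [lra|].
  intros x Hx; pose proof (sol_u_mono 0 x ltac:(lra) ltac:(lra) ltac:(lra)).
  assert (0 < x ^ n) by (apply pow_lt; lra). nra. }
rewrite RInt_cts_scal, RInt_pow0, Hmean in K by cts.
fold Vol in K; pose proof vol_pos; nra.
Qed.

(** The function [exp (- q * u)] is largest at 0, so its weighted integral is at most
    [Vol * exp (- q * u 0)]; the normalisation of [b] does the rest. *)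
Lemma sol_b_exp : B <= b * exp (- q * u 0).
Proof.
pose proof (sol_b _ _ _ _ _ _ _ _ _ _ _ _ HS) as E; fold Vol in E.
assert (K : RInt (fun s => s ^ n * exp (- q * u s)) 0 Rad
            <= RInt (fun s => exp (- q * u 0) * s ^ n) 0 Rad).
{ apply RInt_cts_le; try cts; [lra|].
  intros x Hx; pose proof (sol_u_mono 0 x ltac:(lra) ltac:(lra) ltac:(lra)).
  assert (0 < x ^ n) by (apply pow_lt; lra).
  assert (exp (- q * u x) <= exp (- q * u 0)) by (apply exp_le; nra). nra. }
rewrite RInt_cts_scal, RInt_pow0 in K by cts; fold Vol in K.
pose proof vol_pos; pose proof sol_b_bounds.
apply Rmult_le_reg_l with Vol; auto. nra.
Qed.

(** The chain [B <= b * exp (- q * u 0) <= a * exp (p * u 0) <= A * exp (p * u 0)], whose middle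
    step is [sol_F0]. *)
Lemma sol_exp0_ge : B / A <= exp (p * u 0).
Proof.
pose proof sol_b_exp; pose proof sol_a_bounds; pose proof sol_F0 as K.
unfold F in K; pose proof (exp_pos (p * u 0)).
apply Rmult_le_reg_l with A; [lra|].
replace (A * (B / A)) with B by (field; lra). nra.
Qed.

(** The bound [exp (p * u 0) >= B / A] solved for [u 0], up to sign: [- low] bounds every solution
    from below, and [Kq] then bounds [exp (- q * u)]. *)
Definition low : R := ln (A / B) / p.
Definition Kq : R := exp (q * low).

Lemma sol_u_ge x : 0 <= x <= Rad -> - low <= u x.
Proof.
intros Hx; apply Rle_trans with (u 0); [|apply sol_u_mono; lra].
unfold low.
apply Rmult_le_reg_l with p; auto.
replace (p * - (ln (A / B) / p)) with (- ln (A / B)) by (field; lra).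
rewrite <- ln_Rinv by (apply Rdiv_lt_0_compat; lra).
rewrite <- (ln_exp (p * u 0)).
apply Rcomplements.ln_le.
- apply Rinv_0_lt_compat, Rdiv_lt_0_compat; lra.
- replace (/ (A / B)) with (B / A) by (field; lra). apply sol_exp0_ge.
Qed.

Lemma sol_expq_le x : 0 <= x <= Rad -> exp (- q * u x) <= Kq.
Proof.
intros Hx; apply exp_le; pose proof (sol_u_ge x Hx); nra.
Qed.

(** The chain [B <= b * exp (- q * u 0) <= a * exp (p * u 0) <= a], whose last step is
    [u 0 <= 0]. *)
Lemma sol_a_ge : B <= a.
Proof.
pose proof sol_b_exp; pose proof sol_F0 as K; pose proof sol_a_bounds.
pose proof sol_u0_le; unfold F in K.
assert (exp (p * u 0) <= 1) by (rewrite <- exp_0; apply exp_le; nra).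
nra.
Qed.

(** Integrate the equation from [x] to [y], using [F (u z) >= F (u x)] by monotonicity, and drop the
    nonnegative flux at [x]. *)
Lemma flux_ge x y : 0 <= x -> x <= y -> y <= Rad ->
  F (u x) * ((y ^ S n - x ^ S n) / INR (S n)) <= e ^ 2 * v y.
Proof.
intros Hx Hxy Hy.
assert (Hn : INR (S n) <> 0) by (apply not_0_INR; lia).
assert (K : e ^ 2 * v x - F (u x) * (x ^ S n / INR (S n))
            <= e ^ 2 * v y - F (u x) * (y ^ S n / INR (S n))).
{ apply (derive_nonneg_le
    (fun z => e ^ 2 * v z - F (u x) * (z ^ S n / INR (S n)))); auto.
  - pose proof sol_v_cts; cts.
  - intros z Hz; eexists; split.
    + apply (is_derive_minus (fun z => e ^ 2 * v z)
        (fun z => F (u x) * (z ^ S n / INR (S n)))).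
      * apply (is_derive_scal v); apply Dv; lra.
      * apply (is_derive_scal (fun z => z ^ S n / INR (S n))).
        instantiate (1 := z ^ n).
        auto_derive; auto. simpl pred.
        change (match n with 0%nat => 1 | S _ => INR n + 1 end) with (INR (S n)).
        field; auto.
    + fold (F (u z)); unfold minus, plus, opp; simpl.
      replace (e * (e * 1) * (z ^ n * F (u z) / (e * (e * 1)))
               + - (F (u x) * z ^ n))
        with (z ^ n * (F (u z) - F (u x))) by (field; lra).
      apply Rmult_le_pos; [apply pow_le; lra|].
      pose proof (F_le (u x) (u z) ltac:(apply sol_u_mono; lra)); lra. }
pose proof (flux_nonneg x ltac:(lra)).
assert (0 <= e ^ 2) by (apply pow_le; lra).
unfold Rdiv in *; nra.
Qed.

(** What [flux_ge] with [y = Rad] and [flux_right] give for [F (u r)]. It blows up as [r] tends to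
    [Rad], where the mass collects. *)
Definition KF (r : R) : R := Rad ^ S n * (A - B) / (Rad ^ S n - r ^ S n).

Lemma pow_gap x y : 0 <= x -> x < y -> 0 < y ^ S n - x ^ S n.
Proof.
intros Hx Hxy; enough (x ^ S n < y ^ S n) by lra.
apply Rlt_le_trans with (y ^ n * y).
- apply Rle_lt_trans with (y ^ n * x).
  + simpl; rewrite Rmult_comm; apply Rmult_le_compat_r; auto.
    apply pow_incr; lra.
  + apply Rmult_lt_compat_l; auto; apply pow_lt; lra.
- simpl; lra.
Qed.

Lemma sol_F_le r : 0 <= r < Rad -> F (u r) <= KF r.
Proof.
intros Hr; pose proof (pow_gap r Rad ltac:(lra) ltac:(lra)) as Hg0.
pose proof (flux_ge r Rad ltac:(lra) ltac:(lra) ltac:(lra)) as K.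
rewrite flux_right in K; unfold Vol in K.
assert (Hn : 0 < INR (S n)) by (apply lt_0_INR; lia).
unfold KF; apply Rmult_le_reg_r with (Rad ^ S n - r ^ S n); auto.
replace (Rad ^ S n * (A - B) / (Rad ^ S n - r ^ S n) * (Rad ^ S n - r ^ S n))
  with (Rad ^ S n * (A - B)) by (field; lra).
apply Rmult_le_reg_r with (/ INR (S n)); [now apply Rinv_0_lt_compat|].
unfold Rdiv in K; lra.
Qed.

Lemma sol_aexp_le x : 0 <= x <= Rad -> a * exp (p * u x) <= F (u x) + B * Kq.
Proof.
intros Hx; pose proof (sol_expq_le x Hx); pose proof sol_b_bounds.
pose proof (exp_pos (- q * u x)); unfold F; nra.
Qed.

Lemma sol_exp_le r : 0 <= r < Rad -> exp (p * u r) <= (KF r + B * Kq) / B.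
Proof.
intros Hr; pose proof (sol_aexp_le r ltac:(lra)); pose proof (sol_F_le r Hr).
pose proof sol_a_ge; pose proof (exp_pos (p * u r)).
apply Rmult_le_reg_r with B; auto.
replace ((KF r + B * Kq) / B * B) with (KF r + B * Kq) by (field; lra). nra.
Qed.

Lemma is_derive_G y : is_derive G y (F y).
Proof. unfold G, F; auto_derive; auto; field; lra. Qed.

Lemma G_cts : cts (fun x => G (u x)).
Proof. unfold G; cts. Qed.

Lemma is_derive_Gu x : 0 < x < Rad ->
  is_derive (fun x => G (u x)) x (F (u x) * du x).
Proof.
intros Hx; rewrite Rmult_comm.
apply (is_derive_comp G u x (F (u x)) (du x)); [apply is_derive_G|now apply Du].
Qed.

(** This is the equation multiplied by [v], in which one factor [v] is written out as
    [x ^ n * g x * du x]. *)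
Lemma is_derive_flux2 x : 0 < x < Rad ->
  is_derive (fun x => e ^ 2 * v x ^ 2 / 2) x
    (x ^ n * x ^ n * g x * (F (u x) * du x)).
Proof.
intros Hx; pose proof (Dv x Hx) as D; fold v in D; fold (F (u x)) in D.
replace (x ^ n * x ^ n * g x * (F (u x) * du x))
  with (e ^ 2 / 2 * (2 * v x * (x ^ n * F (u x) / e ^ 2)))
  by (unfold v; field; lra).
apply is_derive_ext with (fun x => e ^ 2 / 2 * (v x ^ 2)); [intros; simpl; field|].
apply is_derive_scal.
evar (l : R); replace (2 * v x * (x ^ n * F (u x) / e ^ 2)) with l.
- apply is_derive_pow, D.
- unfold l; simpl; ring.
Qed.

(** The weight [s ^ n * s ^ n * g s] is frozen at the value [c]. Since [G (u s)] is nondecreasing,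
    the error is the oscillation [eta] of the weight times the increase of [G (u s)]. *)
Lemma energy x y c eta : 0 <= x -> x <= y -> y <= Rad ->
  (forall s, x < s < y -> Rabs (s ^ n * s ^ n * g s - c) <= eta) ->
  Rabs (e ^ 2 * v y ^ 2 / 2 - e ^ 2 * v x ^ 2 / 2 - c * (G (u y) - G (u x)))
  <= eta * (G (u y) - G (u x)).
Proof.
intros Hx Hxy Hy Hw.
assert (Hpos : forall s, x < s < y -> 0 <= F (u s) * du s).
{ intros s Hs; apply Rmult_le_pos; [apply sol_F_nonneg|apply sol_du_nonneg]; lra. }
(* The choices [k = 1] and [k = -1] give the two halves of the absolute value. *)
assert (K : forall k, Rabs k <= 1 ->
  k * (e ^ 2 * v x ^ 2 / 2 - c * G (u x)) + eta * G (u x)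
  <= k * (e ^ 2 * v y ^ 2 / 2 - c * G (u y)) + eta * G (u y)).
{ intros k Hk.
  apply (derive_nonneg_le (fun s =>
    k * (e ^ 2 * v s ^ 2 / 2 - c * G (u s)) + eta * G (u s))); auto.
  - pose proof sol_v_cts; pose proof G_cts.
    apply cts_plus; [apply cts_mult; [apply cts_const|]|].
    + apply cts_minus; [cts|]. apply cts_mult; [apply cts_const|assumption].
    + apply cts_mult; [apply cts_const|assumption].
  - intros s Hs; assert (Hs' : 0 < s < Rad) by lra; eexists; split.
    + apply (is_derive_plus
        (fun s => k * (e ^ 2 * v s ^ 2 / 2 - c * G (u s)))
        (fun s => eta * G (u s))).
      * apply is_derive_scal.
        apply (is_derive_minus (fun s => e ^ 2 * v s ^ 2 / 2)
          (fun s => c * G (u s))); [now apply is_derive_flux2|].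
        apply (is_derive_scal (fun s => G (u s))); now apply is_derive_Gu.
      * apply (is_derive_scal (fun s => G (u s))); now apply is_derive_Gu.
    + specialize (Hpos s Hs); specialize (Hw s Hs).
      unfold minus, plus, opp; simpl.
      set (P := F (u s) * du s) in *; set (w := s ^ n * s ^ n * g s) in *.
      replace (k * (w * P + - (c * P)) + eta * P)
        with ((k * (w - c) + eta) * P) by ring.
      apply Rmult_le_pos; auto.
      assert (Rabs (k * (w - c)) <= eta).
      { rewrite Rabs_mult; pose proof (Rabs_pos (w - c)); nra. }
      pose proof (Rle_abs (- (k * (w - c)))) as L; rewrite Rabs_Ropp in L; lra. }
pose proof (K 1 ltac:(rewrite Rabs_R1; lra)).
pose proof (K (-1) ltac:(rewrite Rabs_left; lra)).
apply Rabs_le; lra.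
Qed.

Lemma Q_nonneg x y : 0 <= x -> x <= y -> y <= Rad -> 0 <= G (u y) - G (u x).
Proof.
intros; enough (G (u x) <= G (u y)) by lra.
apply (derive_nonneg_le (fun x => G (u x))); auto using G_cts.
intros z Hz; eexists; split; [apply is_derive_Gu; lra|].
apply Rmult_le_pos; [apply sol_F_nonneg|apply sol_du_nonneg]; lra.
Qed.

Lemma v_zero : v 0 = 0.
Proof. unfold v; rewrite (sol_left _ _ _ _ _ _ _ _ _ _ _ _ HS); ring. Qed.

Definition K0 : R := 2 * gM / gm ^ 2.

Lemma sol_du_Q y : 0 <= y <= Rad -> (e * du y) ^ 2 <= K0 * (G (u y) - G (u 0)).
Proof.
intros Hy; destruct (Req_dec y 0) as [->|Hne].
{ rewrite (sol_left _ _ _ _ _ _ _ _ _ _ _ _ HS); right; ring. }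
assert (Hyn : 0 < y ^ n) by (apply pow_lt; lra).
pose proof (Hgb y) as Gy.
pose proof (Q_nonneg 0 y ltac:(lra) ltac:(lra) ltac:(lra)) as HQ.
(* With [c] and [eta] both equal to half the upper bound of the weight, the hypothesis of [energy]
   says that the weight lies between 0 and that bound. The factor [y ^ n * y ^ n] then cancels,
   leaving the constant [K0]. *)
assert (K := energy 0 y (y ^ n * y ^ n * gM / 2) (y ^ n * y ^ n * gM / 2)
  ltac:(lra) ltac:(lra) ltac:(lra)).
lapply K; clear K; [intros K|].
- rewrite v_zero in K.
  set (Q := G (u y) - G (u 0)) in *.
  apply Rabs_le_between in K; destruct K as [_ K].
  assert (K' : (y ^ n * y ^ n) * ((e * du y) ^ 2 * g y ^ 2)
               <= (y ^ n * y ^ n) * (2 * gM * Q)).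
  { unfold v in K; simpl in *; nra. }
  apply Rmult_le_reg_l in K'; [|nra].
  assert (gm ^ 2 <= g y ^ 2) by (apply pow_incr; lra).
  assert (0 <= (e * du y) ^ 2) by apply pow2_ge_0.
  unfold K0; apply Rmult_le_reg_r with (gm ^ 2); [apply pow_lt; lra|].
  replace (2 * gM / gm ^ 2 * Q * gm ^ 2) with (2 * gM * Q) by (field; lra).
  nra.
- intros s Hs; pose proof (Hgb s).
  assert (0 <= s ^ n <= y ^ n) by (split; [apply pow_le|apply pow_incr]; lra).
  assert (0 <= s ^ n * s ^ n <= y ^ n * y ^ n) by nra.
  assert (0 <= s ^ n * s ^ n * g s <= y ^ n * y ^ n * gM).
  { split; [nra|apply Rmult_le_compat; nra]. }
  apply Rabs_le; lra.
Qed.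

(** The decaying exponential is absorbed into the growing one: [b * exp (- q * u y) <= B * Kq],
    while [B <= A * exp (p * u y)]. *)
Lemma sol_Q_le y : 0 <= y <= Rad ->
  G (u y) - G (u 0) <= (A / p + A * Kq / q) * exp (p * u y).
Proof.
intros Hy; pose proof sol_a_bounds; pose proof sol_b_bounds.
pose proof (sol_expq_le y Hy) as K1.
assert (K2 : B <= A * exp (p * u y)).
{ apply Rle_trans with (A * exp (p * u 0)).
  - pose proof sol_exp0_ge.
    apply Rle_trans with (A * (B / A)); [right; field; lra|nra].
  - apply Rmult_le_compat_l; [lra|]. apply exp_le.
    apply Rmult_le_compat_l; [lra|apply sol_u_mono; lra]. }
assert (0 < exp (q * low)) by apply exp_pos; fold Kq in *.
assert (Hip : 0 < / p) by now apply Rinv_0_lt_compat.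
assert (Hiq : 0 < / q) by now apply Rinv_0_lt_compat.
assert (G0 : 0 < G (u 0)).
{ unfold G, Rdiv; pose proof (exp_pos (p * u 0)); pose proof (exp_pos (- q * u 0)).
  apply Rplus_lt_0_compat; apply Rmult_lt_0_compat; nra. }
assert (T1 : a / p * exp (p * u y) <= A / p * exp (p * u y)).
{ apply Rmult_le_compat_r; [left; apply exp_pos|]; unfold Rdiv; nra. }
assert (T2 : b / q * exp (- q * u y) <= A * Kq / q * exp (p * u y)).
{ assert (b * exp (- q * u y) <= B * Kq)
    by (apply Rmult_le_compat; try lra; left; apply exp_pos).
  assert (b * exp (- q * u y) <= A * exp (p * u y) * Kq) by nra.
  unfold Rdiv; nra. }
unfold G at 1; lra.
Qed.

Definition S1 : R := sqrt (K0 * (A / p + A * Kq / q)).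

Lemma S1_arg_nonneg : 0 <= K0 * (A / p + A * Kq / q).
Proof.
unfold K0; assert (0 < Kq) by apply exp_pos; pose proof (Hgb 0).
apply Rmult_le_pos.
- apply Rlt_le, Rdiv_lt_0_compat; [lra|now apply pow_lt].
- apply Rplus_le_le_0_compat; apply Rlt_le, Rdiv_lt_0_compat; nra.
Qed.

Lemma sol_du_le y : 0 <= y <= Rad -> e * du y <= S1 * exp (p / 2 * u y).
Proof.
intros Hy.
pose proof (sol_du_Q y Hy) as K1; pose proof (sol_Q_le y Hy) as K2.
assert (0 <= K0).
{ unfold K0; pose proof (Hgb 0); apply Rlt_le, Rdiv_lt_0_compat;
    [lra|now apply pow_lt]. }
assert (HS1 : 0 <= S1) by apply sqrt_pos.
apply Rsqr_incr_0_var.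
2: apply Rmult_le_pos; [auto|left; apply exp_pos].
unfold Rsqr.
replace (S1 * exp (p / 2 * u y) * (S1 * exp (p / 2 * u y)))
  with ((S1 * S1) * (exp (p / 2 * u y) * exp (p / 2 * u y))) by ring.
rewrite <- exp_plus; unfold S1; rewrite sqrt_sqrt by apply S1_arg_nonneg.
replace (p / 2 * u y + p / 2 * u y) with (p * u y) by field.
simpl in K1; nra.
Qed.

(** The outcome of [flux_ge] between [r0] and the midpoint [r1] of [r0] and [Rad]. The flux at [r1]
    involves [exp (p / 2 * u r1)], bounded through [y <= 1 + y ^ 2]; this is the source of the
    [1 +]. *)
Definition Kloc (r0 : R) : R :=
  let r1 := (r0 + Rad) / 2 in
  Rad ^ n * gM * (S1 * (1 + (KF r1 + B * Kq) / B))
  * (INR (S n) / (r1 ^ S n - r0 ^ S n)).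

Lemma sol_F_loc r0 r : 0 <= r -> r <= r0 -> r0 < Rad -> F (u r) <= e * Kloc r0.
Proof.
intros Hr Hr0 HrR.
apply Rle_trans with (F (u r0)); [apply F_le, sol_u_mono; lra|].
unfold Kloc; set (r1 := (r0 + Rad) / 2).
assert (Hr1 : r0 < r1 < Rad) by (unfold r1; lra).
pose proof (pow_gap r0 r1 ltac:(lra) ltac:(lra)) as Hgap.
assert (Hn : 0 < INR (S n)) by (apply lt_0_INR; lia).
pose proof (flux_ge r0 r1 ltac:(lra) ltac:(lra) ltac:(lra)) as K.
(* One factor [e] is kept outside and the other goes with [du r1], where [sol_du_le] controls it. *)
assert (L : e ^ 2 * v r1
            <= e * (Rad ^ n * gM * (S1 * (1 + (KF r1 + B * Kq) / B)))).
{ replace (e ^ 2 * v r1) with (e * (r1 ^ n * g r1 * (e * du r1)))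
    by (unfold v; ring).
  apply Rmult_le_compat_l; [lra|].
  pose proof (Hgb r1); pose proof (sol_du_nonneg r1 ltac:(lra)).
  apply Rmult_le_compat; try nra.
  - apply Rmult_le_pos; [apply pow_le; lra|lra].
  - apply Rmult_le_compat; try lra; [apply pow_le; lra|apply pow_incr; lra].
  - apply Rle_trans with (1 := sol_du_le r1 ltac:(lra)).
    apply Rmult_le_compat_l; [apply sqrt_pos|].
    pose proof (sol_exp_le r1 ltac:(lra)) as E.
    assert (E2 : exp (p * u r1) = exp (p / 2 * u r1) * exp (p / 2 * u r1))
      by (rewrite <- exp_plus; f_equal; field).
    nra. }
apply Rmult_le_reg_r with ((r1 ^ S n - r0 ^ S n) / INR (S n)).
{ now apply Rdiv_lt_0_compat. }
apply Rle_trans with (1 := K), Rle_trans with (1 := L).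
right; field; lra.
Qed.

Definition K2 : R :=
  let r0 := Rad / 2 in
  p / B * ((KF r0 + B * Kq) / p + B * Kq / q
           + (Vol * (A - B)) ^ 2 / (2 * (r0 ^ n * r0 ^ n * gm))).

Lemma KF_pos r : 0 <= r < Rad -> 0 < KF r.
Proof.
intros; apply Rdiv_lt_0_compat; [|apply pow_gap; lra].
apply Rmult_lt_0_compat; [now apply pow_lt|lra].
Qed.

Lemma K2_pos : 0 < K2.
Proof.
unfold K2; set (r0 := Rad / 2).
assert (0 < Kq) by apply exp_pos.
pose proof (KF_pos r0 ltac:(unfold r0; lra)).
assert (0 < r0 ^ n) by (apply pow_lt; unfold r0; lra).
assert (0 < r0 ^ n * r0 ^ n * gm) by (repeat apply Rmult_lt_0_compat; auto).
apply Rmult_lt_0_compat; [now apply Rdiv_lt_0_compat|].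
assert (0 < (KF r0 + B * Kq) / p) by (apply Rdiv_lt_0_compat; nra).
assert (0 < B * Kq / q) by (apply Rdiv_lt_0_compat; nra).
assert (0 <= (Vol * (A - B)) ^ 2 / (2 * (r0 ^ n * r0 ^ n * gm))).
{ apply Rmult_le_pos; [apply pow2_ge_0|].
  left; apply Rinv_0_lt_compat; lra. }
lra.
Qed.

(** The energy identity is used on the outer half only, where the weight has the positive lower
    bound [wl]. By [flux_right] the kinetic term at [Rad] equals a constant over [e ^ 2], and
    [G (u Rad)] dominates [B / p * exp (p * u Rad)]. *)
Lemma sol_exp_right : e <= 1 -> exp (p * u Rad) <= K2 / e ^ 2.
Proof.
intros He1.
unfold K2; set (r0 := Rad / 2).
assert (Hr0 : 0 < r0 < Rad) by (unfold r0; lra).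
set (wl := r0 ^ n * r0 ^ n * gm); set (wu := Rad ^ n * Rad ^ n * gM).
assert (Hwl : 0 < wl).
{ unfold wl; assert (0 < r0 ^ n) by (apply pow_lt; lra).
  repeat apply Rmult_lt_0_compat; auto. }
(* Midpoint and half-width of [[wl, wu]]: the difference [c - eta] is [wl], so the lower half of the
   estimate bounds the increase of [G (u)]. *)
assert (E := energy r0 Rad ((wl + wu) / 2) ((wu - wl) / 2)
  ltac:(lra) ltac:(lra) ltac:(lra)).
lapply E; clear E; [intros E|].
2: { intros s Hs; pose proof (Hgb s).
  assert (0 <= r0 ^ n <= s ^ n) by (split; [apply pow_le|apply pow_incr]; lra).
  assert (0 <= s ^ n <= Rad ^ n) by (split; [apply pow_le|apply pow_incr]; lra).
  assert (wl <= s ^ n * s ^ n * g s <= wu).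
  { unfold wl, wu; split; apply Rmult_le_compat; nra. }
  apply Rabs_le; lra. }
apply Rabs_le_between in E; destruct E as [E _].
pose proof (pow2_ge_0 (v r0)) as Hv0.
assert (He2 : 0 < e ^ 2 <= 1).
{ split; [apply pow_lt; lra|]. simpl; nra. }
pose proof (Q_nonneg r0 Rad ltac:(lra) ltac:(lra) ltac:(lra)) as HQ.
assert (E1 : wl * (G (u Rad) - G (u r0)) <= e ^ 2 * v Rad ^ 2 / 2) by nra.
assert (E2 : e ^ 2 * v Rad ^ 2 = (Vol * (A - B)) ^ 2 / e ^ 2).
{ rewrite <- flux_right; field; lra. }
rewrite E2 in E1.
set (W := (Vol * (A - B)) ^ 2) in *.
assert (E3 : G (u Rad) <= G (u r0) + W / (2 * wl) / e ^ 2).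
{ apply Rmult_le_reg_l with wl; auto.
  replace (wl * (G (u r0) + W / (2 * wl) / e ^ 2))
    with (wl * G (u r0) + W / e ^ 2 / 2) by (field; lra).
  lra. }
pose proof sol_a_ge as Ha; pose proof sol_b_bounds as Hb.
pose proof (sol_expq_le r0 ltac:(lra)) as Eq0.
pose proof (sol_aexp_le r0 ltac:(lra)) as Ea.
pose proof (sol_F_le r0 ltac:(lra)) as EF.
assert (Hip : 0 < / p) by now apply Rinv_0_lt_compat.
assert (Hiq : 0 < / q) by now apply Rinv_0_lt_compat.
assert (E4 : G (u r0) <= (KF r0 + B * Kq) / p + B * Kq / q).
{ unfold G; apply Rplus_le_compat.
  - replace (a / p * exp (p * u r0)) with (a * exp (p * u r0) / p) by (field; lra).
    apply Rmult_le_compat_r; lra.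
  - replace (b / q * exp (- q * u r0)) with (b * exp (- q * u r0) / q)
      by (field; lra).
    apply Rmult_le_compat_r; [lra|].
    apply Rmult_le_compat; try lra; left; apply exp_pos. }
assert (E5 : B / p * exp (p * u Rad) <= G (u Rad)).
{ unfold G; pose proof (exp_pos (p * u Rad)); pose proof (exp_pos (- q * u Rad)).
  assert (0 <= b / q * exp (- q * u Rad)).
  { apply Rmult_le_pos; [apply Rmult_le_pos|]; lra. }
  assert (B / p * exp (p * u Rad) <= a / p * exp (p * u Rad)); [|lra].
  apply Rmult_le_compat_r; [lra|]. apply Rmult_le_compat_r; lra. }
set (C := (KF r0 + B * Kq) / p + B * Kq / q) in *.
assert (HC : 0 <= C).
{ unfold C; assert (0 < Kq) by apply exp_pos.
  pose proof (KF_pos r0 ltac:(lra)).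
  apply Rplus_le_le_0_compat; apply Rmult_le_pos; nra. }
(* The assumption [e <= 1] lets the bounded part [C] be absorbed into [C / e ^ 2]. *)
assert (E6 : B / p * exp (p * u Rad) <= (C + W / (2 * wl)) / e ^ 2).
{ apply Rle_trans with (C + W / (2 * wl) / e ^ 2); [lra|].
  apply Rmult_le_reg_r with (e ^ 2); [lra|].
  replace ((C + W / (2 * wl)) / e ^ 2 * e ^ 2) with (C + W / (2 * wl))
    by (field; lra).
  replace ((C + W / (2 * wl) / e ^ 2) * e ^ 2) with (C * e ^ 2 + W / (2 * wl))
    by (field; lra).
  nra. }
apply Rmult_le_reg_l with (B / p); [now apply Rdiv_lt_0_compat|].
apply Rle_trans with (1 := E6); right; field; repeat split; lra.
Qed.

End Estimates.

(** * Limits as [e] decreases to 0, and concentration at the endpoint *)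

Lemma at_right_lt (c : R) : 0 < c -> at_right 0 (fun e => 0 < e < c).
Proof.
intros Hc; exists (mkposreal c Hc); intros e He Hpos; split; auto.
unfold ball in He; simpl in He; unfold AbsRing_ball, abs, minus, plus, opp in He;
  simpl in He.
apply Rabs_def2 in He; lra.
Qed.

Lemma at_right_and (P Q S : R -> Prop) : at_right 0 P -> at_right 0 Q ->
  (forall e, P e -> Q e -> S e) -> at_right 0 S.
Proof.
intros HP HQ H; apply filter_imp with (2 := filter_and _ _ HP HQ).
intros e [He1 He2]; auto.
Qed.

Lemma lim_at_right (f : R -> R) (l : R) :
  (forall eta, 0 < eta -> at_right 0 (fun e => Rabs (f e - l) <= eta)) <->
  filterlim f (at_right 0) (locally l).
Proof.
split.
- intros H; apply filterlim_locally; intros eta.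
  pose proof (cond_pos eta) as Hp.
  apply filter_imp with (2 := H (eta / 2) ltac:(lra)).
  intros e He; unfold ball; simpl; unfold AbsRing_ball, abs, minus, plus, opp; simpl.
  unfold Rminus in He; lra.
- intros H eta Heta.
  pose proof (proj1 (filterlim_locally f l) H (mkposreal eta Heta)) as K.
  apply filter_imp with (2 := K).
  intros e He; unfold ball in He; simpl in He;
    unfold AbsRing_ball, abs, minus, plus, opp in He; simpl in He.
  left; exact He.
Qed.

Lemma lim_ext_pos (f h : R -> R) (l : R) : (forall e, 0 < e -> f e = h e) ->
  filterlim f (at_right 0) (locally l) -> filterlim h (at_right 0) (locally l).
Proof.
intros E; apply filterlim_ext_loc.
apply filter_imp with (2 := at_right_lt 1 Rlt_0_1); intros e He; apply E; lra.
Qed.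

Lemma lim_plus (f h : R -> R) (l m : R) :
  filterlim f (at_right 0) (locally l) -> filterlim h (at_right 0) (locally m) ->
  filterlim (fun e => f e + h e) (at_right 0) (locally (l + m)).
Proof.
intros Hf Hh; apply (filterlim_comp_2 f h Rplus Hf Hh).
apply (filterlim_plus (V := R_NormedModule) l m).
Qed.

Lemma lim_mult (f h : R -> R) (l m : R) :
  filterlim f (at_right 0) (locally l) -> filterlim h (at_right 0) (locally m) ->
  filterlim (fun e => f e * h e) (at_right 0) (locally (l * m)).
Proof.
intros Hf Hh; apply (filterlim_comp_2 f h Rmult Hf Hh).
apply (filterlim_mult (K := R_AbsRing) l m).
Qed.

Lemma lim_cts (f h : R -> R) (l : R) : continuous h l ->
  filterlim f (at_right 0) (locally l) ->
  filterlim (fun e => h (f e)) (at_right 0) (locally (h l)).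
Proof. intros Hh Hf; apply (filterlim_comp _ _ _ f h _ _ _ Hf Hh). Qed.

Lemma continuous_Rinv (x : R) : x <> 0 -> continuous Rinv x.
Proof.
intros; apply (@ex_derive_continuous R_AbsRing R_NormedModule); auto_derive; auto.
Qed.

Lemma lim_const (c : R) : filterlim (fun _ : R => c) (at_right 0) (locally c).
Proof. apply filterlim_const. Qed.

(** Locally uniform convergence to 0 on the half-open interval, which leaves room for concentration
    at [Rad]. *)
Definition loc_small (Rad : R) (f : R -> R -> R) : Prop :=
  forall r0 eta, 0 <= r0 < Rad -> 0 < eta ->
    at_right 0 (fun e => forall r, 0 <= r <= r0 -> Rabs (f e r) <= eta).

(* A Vitali-type argument: the domination by [M + d w] for every [d > 0] is
   uniform integrability. *)
Lemma loc_small_lim (Rad : R) (f w : R -> R -> R) (h : R -> R) (K : R) :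
  0 < Rad -> cts h ->
  (forall e, 0 < e < 1 -> cts (f e)) -> (forall e, 0 < e < 1 -> cts (w e)) ->
  (forall e r, 0 < e < 1 -> 0 <= r <= Rad -> 0 <= w e r) ->
  (forall e, 0 < e < 1 -> RInt (w e) 0 Rad <= K) ->
  (forall d, 0 < d -> exists M, forall e r, 0 < e < 1 -> 0 <= r <= Rad ->
     Rabs (f e r) <= M + d * w e r) ->
  loc_small Rad f ->
  filterlim (fun e => RInt (fun r => h r * f e r) 0 Rad) (at_right 0) (locally 0).
Proof.
intros HR Hh Hf Hw Hw0 HK Hd Hs; apply lim_at_right; intros eta Heta.
destruct (cts_bounded h 0 Rad ltac:(lra) Hh) as [H [HH Hhb]].
assert (K0 : 0 <= K).
{ apply Rle_trans with (2 := HK (1/2) ltac:(lra)).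
  apply Rle_trans with (RInt (fun _ => 0) 0 Rad).
  - rewrite RInt_cts_const; lra.
  - apply RInt_cts_le; [lra|cts|apply Hw; lra|intros; apply Hw0; lra]. }
set (d := eta / (3 * H * (K + 1))).
assert (Hdp : 0 < d) by (apply Rdiv_lt_0_compat; [lra|repeat apply Rmult_lt_0_compat; lra]).
destruct (Hd d Hdp) as [M0 HM0].
set (M := Rmax M0 1).
assert (HM1 : 1 <= M) by apply Rmax_r.
assert (HM2 : M0 <= M) by apply Rmax_l.
set (t := Rmin Rad (eta / (3 * H * M))).
assert (Ht : 0 < t).
{ apply Rmin_glb_lt; auto; apply Rdiv_lt_0_compat; [lra|].
  repeat apply Rmult_lt_0_compat; lra. }
assert (Ht1 : t <= Rad) by apply Rmin_l.
assert (Ht2 : t <= eta / (3 * H * M)) by apply Rmin_r.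
set (s := eta / (3 * H * Rad)).
assert (Hsp : 0 < s).
{ apply Rdiv_lt_0_compat; [lra|]; repeat apply Rmult_lt_0_compat; lra. }
apply (at_right_and _ _ _ (at_right_lt 1 Rlt_0_1) (Hs (Rad - t) s ltac:(lra) Hsp)).
intros e He Hse.
pose proof (Hf e He) as Hfe; pose proof (Hw e He) as Hwe.
assert (Chf : cts (fun r => h r * f e r)) by cts.
rewrite Rminus_0_r.
rewrite (RInt_cts_split _ 0 (Rad - t) Rad Chf).
apply Rle_trans with (1 := Rabs_triang _ _).
assert (B1 : Rabs (RInt (fun r => h r * f e r) 0 (Rad - t)) <= eta / 3).
{ apply Rle_trans with ((Rad - t - 0) * (H * s)).
  - apply abs_RInt_le_const; [lra|now apply cts_RInt|].
    intros r Hr; rewrite Rabs_mult; apply Rmult_le_compat; try apply Rabs_pos.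
    + apply Hhb; lra.
    + apply Hse; lra.
  - apply Rle_trans with (Rad * (H * s)).
    + apply Rmult_le_compat_r; [|lra]. apply Rmult_le_pos; lra.
    + right; unfold s; field; lra. }
assert (B2 : Rabs (RInt (fun r => h r * f e r) (Rad - t) Rad) <= 2 * eta / 3).
{ apply Rle_trans with (1 := RInt_cts_abs _ (Rad - t) Rad ltac:(lra) Chf).
  apply Rle_trans with (RInt (fun r => H * M + H * d * w e r) (Rad - t) Rad).
  - apply RInt_cts_le; [lra|cts|cts|].
    intros r Hr; rewrite Rabs_mult.
    apply Rle_trans with (H * (M + d * w e r)); [|right; ring].
    apply Rmult_le_compat; try apply Rabs_pos.
    + apply Hhb; lra.
    + apply Rle_trans with (1 := HM0 e r He ltac:(lra)); lra.
  - rewrite RInt_cts_plus, RInt_cts_const, RInt_cts_scal by cts.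
    assert (I : RInt (w e) (Rad - t) Rad <= K).
    { apply Rle_trans with (2 := HK e He).
      rewrite (RInt_cts_split _ 0 (Rad - t) Rad Hwe).
      assert (0 <= RInt (w e) 0 (Rad - t)); [|lra].
      apply Rle_trans with (RInt (fun _ => 0) 0 (Rad - t)).
      - rewrite RInt_cts_const; lra.
      - apply RInt_cts_le; [lra|cts|auto|intros; apply Hw0; lra]. }
    assert (T1 : H * M * (Rad - (Rad - t)) <= eta / 3).
    { apply Rle_trans with (H * M * (eta / (3 * H * M))).
      - apply Rmult_le_compat_l; [apply Rmult_le_pos; lra|lra].
      - right; field; lra. }
    assert (T2 : H * d * RInt (w e) (Rad - t) Rad <= eta / 3).
    { apply Rle_trans with (H * d * (K + 1)).
      - apply Rmult_le_compat_l; [apply Rmult_le_pos; lra|lra].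
      - right; unfold d; field; lra. }
    apply Rle_trans with (1 := Rplus_le_compat _ _ _ _ T1 T2); lra. }
lra.
Qed.

Lemma loc_small_lim_bounded (Rad : R) (f : R -> R -> R) (h : R -> R) (M : R) :
  0 < Rad -> cts h -> (forall e, 0 < e < 1 -> cts (f e)) ->
  (forall e r, 0 < e < 1 -> 0 <= r <= Rad -> Rabs (f e r) <= M) ->
  loc_small Rad f ->
  filterlim (fun e => RInt (fun r => h r * f e r) 0 Rad) (at_right 0) (locally 0).
Proof.
intros HR Hh Hf HM Hs.
apply (loc_small_lim Rad f (fun _ _ => 0) h 0); auto.
- intros; cts.
- intros; lra.
- intros; rewrite RInt_cts_const; lra.
- intros d _; exists M; intros e r He Hr; specialize (HM e r He Hr); lra.
Qed.

(** Near [Rad] the test function is small and the mass bounded; away from [Rad] the family itself is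
    small. Bounded mass replaces the domination asked for in [loc_small_lim]. *)
Lemma dirac_lim_zero (Rad : R) (f : R -> R -> R) (h : R -> R) (K : R) :
  0 < Rad -> cts h -> h Rad = 0 ->
  (forall e, 0 < e < 1 -> cts (f e)) ->
  (forall e r, 0 < e < 1 -> 0 <= r <= Rad -> 0 <= f e r) ->
  (forall e, 0 < e < 1 -> RInt (f e) 0 Rad <= K) ->
  loc_small Rad f ->
  filterlim (fun e => RInt (fun r => h r * f e r) 0 Rad) (at_right 0) (locally 0).
Proof.
intros HR Hh Hh0 Hf Hf0 HK Hs; apply lim_at_right; intros eta Heta.
destruct (cts_bounded h 0 Rad ltac:(lra) Hh) as [H [HH Hhb]].
set (K' := Rmax K 1).
assert (1 <= K') by apply Rmax_r. assert (K <= K') by apply Rmax_l.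
set (d := eta / (2 * K')).
assert (Hd : 0 < d) by (apply Rdiv_lt_0_compat; lra).
destruct (cts_left_close h Rad d Hh Hd) as [t0 [Ht0 Hc]].
set (t := Rmin Rad t0).
assert (Ht : 0 < t) by (apply Rmin_glb_lt; lra).
assert (t <= Rad) by apply Rmin_l. assert (t <= t0) by apply Rmin_r.
set (s := eta / (2 * H * Rad)).
assert (Hsp : 0 < s).
{ apply Rdiv_lt_0_compat; [lra|]; repeat apply Rmult_lt_0_compat; lra. }
apply (at_right_and _ _ _ (at_right_lt 1 Rlt_0_1) (Hs (Rad - t) s ltac:(lra) Hsp)).
intros e He Hse; rewrite Rminus_0_r.
pose proof (Hf e He) as Hfe.
apply Rle_trans with (1 := RInt_cts_abs _ 0 Rad ltac:(lra) (cts_mult _ _ Hh Hfe)).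
apply Rle_trans with (RInt (fun r => d * f e r + H * s) 0 Rad).
- apply RInt_cts_le; [lra|cts|cts|].
  intros r Hr; rewrite Rabs_mult.
  pose proof (Hf0 e r He ltac:(lra)).
  destruct (Rle_dec r (Rad - t)) as [Hle|Hgt].
  + apply Rle_trans with (H * s); [|nra].
    apply Rmult_le_compat; try apply Rabs_pos; [apply Hhb|apply Hse]; lra.
  + specialize (Hc r ltac:(lra)); rewrite Hh0, Rminus_0_r in Hc.
    rewrite (Rabs_pos_eq (f e r)) by auto.
    assert (0 < H * s) by (apply Rmult_lt_0_compat; lra). nra.
- rewrite RInt_cts_plus, RInt_cts_const, RInt_cts_scal by cts.
  assert (T1 : d * RInt (f e) 0 Rad <= eta / 2).
  { apply Rle_trans with (d * K').
    - apply Rmult_le_compat_l; [lra|]; apply Rle_trans with K; auto.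
    - right; unfold d; field; lra. }
  assert (T2 : H * s * (Rad - 0) <= eta / 2) by (right; unfold s; field; lra).
  apply Rle_trans with (1 := Rplus_le_compat _ _ _ _ T1 T2); lra.
Qed.

(** One test function [k] determines the limit for all: [h - l * k] with [l = h Rad / k Rad]
    vanishes at [Rad], so [dirac_lim_zero] applies to it. *)
Lemma dirac_lim (Rad : R) (f : R -> R -> R) (k : R -> R) (c K : R) :
  0 < Rad -> cts k -> k Rad <> 0 ->
  (forall e, 0 < e < 1 -> cts (f e)) ->
  (forall e r, 0 < e < 1 -> 0 <= r <= Rad -> 0 <= f e r) ->
  (forall e, 0 < e < 1 -> RInt (f e) 0 Rad <= K) ->
  loc_small Rad f ->
  filterlim (fun e => RInt (fun r => k r * f e r) 0 Rad) (at_right 0)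
    (locally (c * k Rad)) ->
  forall h, cts h ->
  filterlim (fun e => RInt (fun r => h r * f e r) 0 Rad) (at_right 0)
    (locally (c * h Rad)).
Proof.
intros HR Hk Hk0 Hf Hf0 HK Hs Hlim h Hh.
set (l := h Rad / k Rad).
assert (Hz := dirac_lim_zero Rad f (fun r => h r - l * k r) K HR ltac:(cts)
  ltac:(unfold l; field; auto) Hf Hf0 HK Hs).
pose proof (lim_plus _ _ _ _ Hz (lim_mult _ _ _ _ (lim_const l) Hlim)) as E.
replace (0 + l * (c * k Rad)) with (c * h Rad) in E by (unfold l; field; auto).
revert E; apply filterlim_ext_loc.
apply filter_imp with (2 := at_right_lt 1 Rlt_0_1); intros e He.
pose proof (Hf e He) as Hfe.
rewrite <- RInt_cts_scal by cts.
rewrite <- RInt_cts_plus by cts.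
apply (RInt_ext (V := R_CompleteNormedModule)); intros x _; simpl; ring.
Qed.

Lemma at_right_scal_le (K eta : R) : 0 < eta -> at_right 0 (fun e => e * K <= eta).
Proof.
intros Heta; pose proof (Rabs_pos K).
assert (0 < eta / (Rabs K + 1)) by (apply Rdiv_lt_0_compat; lra).
apply filter_imp with (2 := at_right_lt _ H0); intros e He.
pose proof (Rle_abs K).
apply Rle_trans with (eta / (Rabs K + 1) * (Rabs K + 1)); [nra|].
right; field; lra.
Qed.

Lemma exp_sub1_small (eta : R) : 0 < eta ->
  exists d, 0 < d /\ forall y, Rabs y <= d -> Rabs (exp y - 1) <= eta.
Proof.
intros Heta.
destruct (proj1 (filterlim_locally exp (exp 0)) (cts_exp _ cts_id 0)
  (mkposreal eta Heta)) as [d Hd].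
exists (d / 2); split; [pose proof (cond_pos d); lra|].
intros y Hy; left.
rewrite <- exp_0; apply Hd.
unfold ball; simpl; unfold AbsRing_ball, abs, minus, plus, opp; simpl.
rewrite Ropp_0, Rplus_0_r; pose proof (cond_pos d); lra.
Qed.

Lemma exp_convex (x y : R) : exp x * (y - x) <= exp y - exp x.
Proof.
pose proof (exp_ineq1_le (y - x)).
replace (exp y) with (exp x * exp (y - x)) by (rewrite <- exp_plus; f_equal; ring).
pose proof (exp_pos x); nra.
Qed.

(** The square of [exp (x / 2) >= 1 + x / 2]. Quadratic growth suffices to beat a linear function
    with an arbitrarily small factor. *)
Lemma exp_ge_sqr (x : R) : 0 <= x -> x ^ 2 / 4 <= exp x.
Proof.
intros Hx; pose proof (exp_ineq1_le (x / 2)).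
replace (exp x) with (exp (x / 2) * exp (x / 2))
  by (rewrite <- exp_plus; f_equal; field).
simpl; nra.
Qed.

(** Truncation at the level [la]: below it the power is monotone, above it
    [x ^ (theta - 1) <= la ^ (theta - 1)] because [theta <= 1]. *)
Lemma powp_young (theta la x : R) : 0 < theta <= 1 -> 0 < la -> 0 <= x ->
  powp x theta <= Rpower la theta + Rpower la (theta - 1) * x.
Proof.
intros Ht Hla Hx.
assert (0 < Rpower la theta) by apply exp_pos.
assert (0 < Rpower la (theta - 1)) by apply exp_pos.
destruct (Rle_dec x la) as [Hle|Hgt].
- apply Rle_trans with (powp la theta); [apply powp_le; lra|].
  rewrite powp_pos by auto; nra.
- rewrite powp_pos by lra.
  enough (Rpower x theta <= Rpower la (theta - 1) * x) by lra.
  replace theta with ((theta - 1) + 1) at 1 by ring.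
  rewrite Rpower_plus, Rpower_1 by lra.
  apply Rmult_le_compat_r; auto.
  replace (theta - 1) with (- (1 - theta)) by ring.
  rewrite !Rpower_Ropp; apply Rinv_le_contravar; [apply exp_pos|].
  apply Rle_Rpower_l; lra.
Qed.

Ltac use L HD He HS := eapply L; try exact HD; try exact He; try exact HS.

(** * Limits of a family of solutions when [B < A] *)

Section Family.

Context (n : nat) (Rad : R) (g : R -> R) (gm gM A B p q : R)
  (U dU : R -> R -> R) (a b : R -> R).
Hypothesis HD : data Rad g gm gM A B p q.
Hypothesis HS : forall e, 0 < e ->
  sol n Rad g A B p q e (U e) (dU e) (a e) (b e).

(** [Q e r] is the increment of [G (u)] from the centre to [r], and [c] is the mass that [F] will
    deposit at [Rad]. *)
Let F := fun e y => a e * exp (p * y) - b e * exp (- q * y).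
Let Q := fun e r => a e / p * exp (p * U e r) + b e / q * exp (- q * U e r)
  - (a e / p * exp (p * U e 0) + b e / q * exp (- q * U e 0)).
Let Kq' := Kq A B p q.
Let c := Rad * (A - B) / INR (S n).

Let HR := data_R _ _ _ _ _ _ _ _ HD.
Let Hg := data_g _ _ _ _ _ _ _ _ HD.
Let Hgm := data_gm _ _ _ _ _ _ _ _ HD.
Let Hgb := data_gb _ _ _ _ _ _ _ _ HD.
Let HB := data_B _ _ _ _ _ _ _ _ HD.
Let HA := data_A _ _ _ _ _ _ _ _ HD.
Let Hp := data_p _ _ _ _ _ _ _ _ HD.
Let Hq := data_q _ _ _ _ _ _ _ _ HD.

Lemma fam_U_cts e : 0 < e -> cts (U e).
Proof. intros He; exact (sol_cts _ _ _ _ _ _ _ _ _ _ _ _ (HS e He)). Qed.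

Lemma fam_dU_cts e : 0 < e -> cts (dU e).
Proof. intros He; exact (sol_cts' _ _ _ _ _ _ _ _ _ _ _ _ (HS e He)). Qed.

Lemma fam_F_cts e : 0 < e -> cts (fun r => F e (U e r)).
Proof. intros He; pose proof (fam_U_cts e He); unfold F; cts. Qed.

Lemma fam_Q_cts e : 0 < e -> cts (Q e).
Proof. intros He; pose proof (fam_U_cts e He); unfold Q; cts. Qed.

Lemma Kq_pos : 0 < Kq'.
Proof. apply exp_pos. Qed.

Lemma fam_a e : 0 < e -> B <= a e <= A.
Proof.
intros He; split; [exact (sol_a_ge _ _ _ _ _ _ _ _ _ _ _ _ _ _ HD He (HS e He))|].
use sol_a_bounds HD He (HS e He).
Qed.

Lemma fam_b e : 0 < e -> 0 < b e <= B.
Proof. intros He; use sol_b_bounds HD He (HS e He). Qed.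

Lemma fam_F_nonneg e r : 0 < e -> 0 <= r <= Rad -> 0 <= F e (U e r).
Proof. intros He Hr; exact (sol_F_nonneg _ _ _ _ _ _ _ _ _ _ _ _ _ _ HD He (HS e He) r Hr). Qed.

Lemma fam_F_small : loc_small Rad (fun e r => F e (U e r)).
Proof.
intros r0 eta Hr0 Heta.
apply (at_right_and _ _ _ (at_right_lt 1 Rlt_0_1)
  (at_right_scal_le (Kloc n Rad gm gM A B p q r0) eta Heta)).
intros e [He _] HK r Hr.
rewrite Rabs_pos_eq by (apply fam_F_nonneg; lra).
apply Rle_trans with (2 := HK).
exact (sol_F_loc _ _ _ _ _ _ _ _ _ _ _ _ _ _ HD He (HS e He) r0 r (proj1 Hr) (proj2 Hr) (proj2 Hr0)).
Qed.

(** The normalisations of [a] and [b] fix this integral for every [e], which makes [r ^ n] the test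
    function that identifies the limit of [F]. *)
Lemma fam_F_mass e : 0 < e ->
  RInt (fun r => r ^ n * F e (U e r)) 0 Rad = c * Rad ^ n :> R.
Proof.
intros He; pose proof (HS e He) as HSe; pose proof (fam_U_cts e He).
assert (Hn : INR (S n) <> 0) by (apply not_0_INR; lia).
transitivity (RInt (fun r => a e * (r ^ n * exp (p * U e r))
                      + - b e * (r ^ n * exp (- q * U e r))) 0 Rad).
{ apply (RInt_ext (V := R_CompleteNormedModule)); intros; unfold F; simpl; ring. }
rewrite RInt_cts_plus by cts.
rewrite (RInt_cts_scal (fun r => r ^ n * exp (p * U e r))) by cts.
rewrite (RInt_cts_scal (fun r => r ^ n * exp (- q * U e r))) by cts.
rewrite (sol_a _ _ _ _ _ _ _ _ _ _ _ _ HSe).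
replace (- b e * RInt (fun r => r ^ n * exp (- q * U e r)) 0 Rad)
  with (- (b e * RInt (fun r => r ^ n * exp (- q * U e r)) 0 Rad)) by ring.
rewrite (sol_b _ _ _ _ _ _ _ _ _ _ _ _ HSe).
unfold c; simpl pow; field; auto.
Qed.

(** The weight [r ^ n] degenerates at 0, so the inner half is handled by [KF]; on the outer half the
    weight is at least [r0 ^ n] and the weighted mass applies. *)
Lemma fam_F_int : exists K, forall e, 0 < e < 1 ->
  RInt (fun r => F e (U e r)) 0 Rad <= K.
Proof.
set (r0 := Rad / 2).
assert (Hr0 : 0 < r0 ^ n) by (apply pow_lt; unfold r0; lra).
exists (KF n Rad A B r0 * (Rad - 0) + / (r0 ^ n) * (c * Rad ^ n)).
intros e He; assert (He' : 0 < e) by lra; rewrite <- (fam_F_mass e He').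
pose proof (fam_F_cts e ltac:(lra)).
rewrite <- RInt_cts_const, <- RInt_cts_scal, <- RInt_cts_plus by cts.
assert (HKF : 0 < KF n Rad A B r0).
{ use KF_pos HD HD HD; unfold r0; lra. }
apply RInt_cts_le; [lra|cts|cts|].
intros r Hr; pose proof (fam_F_nonneg e r ltac:(lra) ltac:(lra)).
assert (0 < / r0 ^ n) by now apply Rinv_0_lt_compat.
assert (0 < r ^ n) by (apply pow_lt; lra).
destruct (Rle_dec r r0) as [Hle|Hgt].
- apply Rle_trans with (KF n Rad A B r0).
  + apply Rle_trans with (F e (U e r0)).
    * use F_le HD He' (HS e He').
      use sol_u_mono HD He' (HS e He'); unfold r0 in *; lra.
    * use sol_F_le HD He' (HS e He'); unfold r0; lra.
  + assert (0 <= / r0 ^ n * (r ^ n * F e (U e r))); [|lra].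
    apply Rmult_le_pos; [lra|nra].
- apply Rle_trans with (/ r0 ^ n * (r ^ n * F e (U e r))); [|lra].
  rewrite <- Rmult_assoc.
  rewrite <- (Rmult_1_l (F e (U e r))) at 1.
  apply Rmult_le_compat_r; auto.
  rewrite <- (Rinv_l (r0 ^ n)) by lra.
  apply Rmult_le_compat_l; [lra|]. apply pow_incr; unfold r0 in *; lra.
Qed.

Lemma fam_expp_le e r : 0 < e -> 0 <= r <= Rad ->
  exp (p * U e r) <= F e (U e r) / B + Kq'.
Proof.
intros He Hr; pose proof (sol_aexp_le _ _ _ _ _ _ _ _ _ _ _ _ _ _ HD He (HS e He) r Hr) as K.
pose proof (fam_a e He); pose proof (exp_pos (p * U e r)).
apply Rmult_le_reg_l with B; auto.
replace (B * (F e (U e r) / B + Kq')) with (F e (U e r) + B * Kq') by (field; lra).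
unfold F, Kq'; nra.
Qed.

Lemma fam_expp_int : exists K, forall e, 0 < e < 1 ->
  RInt (fun r => exp (p * U e r)) 0 Rad <= K.
Proof.
destruct fam_F_int as [K HK].
exists (/ B * K + Kq' * (Rad - 0)).
intros e He; pose proof (fam_F_cts e ltac:(lra)); pose proof (fam_U_cts e ltac:(lra)).
apply Rle_trans with (RInt (fun r => / B * F e (U e r) + Kq') 0 Rad).
- apply RInt_cts_le; [lra|cts|cts|].
  intros r Hr; pose proof (fam_expp_le e r ltac:(lra) ltac:(lra)).
  unfold Rdiv in *; lra.
- rewrite RInt_cts_plus, RInt_cts_const by cts.
  rewrite (RInt_cts_scal (fun r => F e (U e r))) by cts.
  apply Rplus_le_compat_r, Rmult_le_compat_l.
  + left; now apply Rinv_0_lt_compat.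
  + now apply HK.
Qed.

(** Small [F] forces small oscillation: since [F e (U e 0) >= 0], convexity of [exp] gives [F e (U e
    r) >= a e * exp (p * U e 0) * p * (U e r - U e 0)], and [k] is the lower bound of the factor in
    front. *)
Lemma fam_osc_small : loc_small Rad (fun e r => U e r - U e 0).
Proof.
intros r0 eta Hr0 Heta.
set (k := B * (B / A) * p).
assert (Hk : 0 < k).
{ unfold k; repeat apply Rmult_lt_0_compat; auto; apply Rinv_0_lt_compat; lra. }
apply (at_right_and _ _ _ (at_right_lt 1 Rlt_0_1)
  (fam_F_small r0 (k * eta) Hr0 ltac:(apply Rmult_lt_0_compat; auto))).
intros e [He _] HF r Hr.
specialize (HF r Hr).
rewrite Rabs_pos_eq in HF by (apply fam_F_nonneg; lra).
assert (Hm : U e 0 <= U e r) by (use sol_u_mono HD He (HS e He); lra).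
rewrite Rabs_pos_eq by lra.
apply Rmult_le_reg_l with k; auto.
apply Rle_trans with (2 := HF).
pose proof (sol_F0 _ _ _ _ _ _ _ _ _ _ _ _ _ _ HD He (HS e He)) as H0.
pose proof (sol_exp0_ge _ _ _ _ _ _ _ _ _ _ _ _ _ _ HD He (HS e He)) as Hexp.
pose proof (fam_a e He) as Ha; pose proof (fam_b e He) as Hb.
pose proof (exp_convex (p * U e 0) (p * U e r)) as Hc.
assert (exp (- q * U e r) <= exp (- q * U e 0)) by (apply exp_le; nra).
assert (HBA : 0 < B / A) by (apply Rdiv_lt_0_compat; lra).
apply Rle_trans with (a e * (exp (p * U e r) - exp (p * U e 0))).
- apply Rle_trans with (a e * (exp (p * U e 0) * (p * U e r - p * U e 0))).
  + unfold k.
    replace (B * (B / A) * p * (U e r - U e 0))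
      with (B * ((B / A) * (p * U e r - p * U e 0))) by ring.
    assert (0 <= p * U e r - p * U e 0) by nra.
    apply Rmult_le_compat; try lra; [nra|].
    apply Rmult_le_compat_r; auto.
  + apply Rmult_le_compat_l; lra.
- unfold F; nra.
Qed.

(** With [D = U e r + l >= 0] one has [D <= / t + t * D ^ 2], and [t] is chosen so that [exp_ge_sqr]
    turns the quadratic term into at most [d * exp (p * U e r)]. *)
Lemma fam_osc_dom d : 0 < d -> exists M, forall e r, 0 < e < 1 -> 0 <= r <= Rad ->
  Rabs (U e r - U e 0) <= M + d * exp (p * U e r).
Proof.
intros Hd.
set (l := low A B p).
set (t := d * p ^ 2 / (4 * exp (p * l))).
assert (Hpl : 0 < exp (p * l)) by apply exp_pos.
assert (Ht : 0 < t).
{ apply Rdiv_lt_0_compat; [|lra]; apply Rmult_lt_0_compat; auto; now apply pow_lt. }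
exists (/ t); intros e r [He _] Hr.
assert (Hm : U e 0 <= U e r) by (use sol_u_mono HD He (HS e He); lra).
assert (HL : - l <= U e 0) by (use sol_u_ge HD He (HS e He); lra).
rewrite Rabs_pos_eq by lra.
set (D := U e r + l).
assert (HDp : 0 <= D) by (unfold D; lra).
apply Rle_trans with D; [unfold D; lra|].
assert (Ip : 0 < / t) by now apply Rinv_0_lt_compat.
apply Rle_trans with (/ t + t * D ^ 2).
- assert (t * / t = 1) by (field; lra).
  assert (0 <= t * (D - / t) ^ 2) by (apply Rmult_le_pos; [lra|apply pow2_ge_0]).
  simpl in *; nra.
- apply Rplus_le_compat_l.
  pose proof (exp_ge_sqr (p * D) ltac:(nra)) as E.
  replace (p * D) with (p * U e r + p * l) in E by (unfold D; ring).
  rewrite exp_plus in E.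
  apply Rmult_le_reg_r with (exp (p * l)); auto.
  replace (t * D ^ 2 * exp (p * l)) with (d * ((p * U e r + p * l) ^ 2 / 4))
    by (unfold t, D; field; lra).
  nra.
Qed.

(** Because [U e] has zero weighted mean, the weighted integral of [U e r - U e 0] is exactly
    [- V * U e 0], and [loc_small_lim] sends it to 0. *)
Lemma fam_U0_lim : filterlim (fun e => U e 0) (at_right 0) (locally 0).
Proof.
destruct fam_expp_int as [K HK].
assert (L := loc_small_lim Rad (fun e r => U e r - U e 0)
  (fun e r => exp (p * U e r)) (fun r => r ^ n) K HR ltac:(cts)).
assert (E : filterlim (fun e => RInt (fun r => r ^ n * (U e r - U e 0)) 0 Rad)
  (at_right 0) (locally 0)).
{ apply L; auto.
  - intros e He; pose proof (fam_U_cts e ltac:(lra)); cts.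
  - intros e He; pose proof (fam_U_cts e ltac:(lra)); cts.
  - intros; left; apply exp_pos.
  - apply fam_osc_dom.
  - apply fam_osc_small. }
set (V := Rad ^ S n / INR (S n)).
assert (HV : 0 < V) by (use vol_pos HD HD HD).
pose proof (lim_mult _ _ _ _ (lim_const (- / V)) E) as E2.
rewrite Rmult_0_r in E2; revert E2; apply lim_ext_pos.
intros e He; pose proof (fam_U_cts e He).
transitivity (- / V * (RInt (fun r => r ^ n * U e r + - U e 0 * r ^ n) 0 Rad)).
{ f_equal; apply (RInt_ext (V := R_CompleteNormedModule)); intros; simpl; ring. }
rewrite RInt_cts_plus, RInt_cts_scal, RInt_pow0 by cts.
rewrite (sol_mean _ _ _ _ _ _ _ _ _ _ _ _ (HS e He)).
fold V; field; lra.
Qed.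

Lemma fam_U_small : loc_small Rad U.
Proof.
intros r0 eta Hr0 Heta.
apply (at_right_and _ _ _ (fam_osc_small r0 (eta / 2) Hr0 ltac:(lra))
  (proj2 (lim_at_right _ _) fam_U0_lim (eta / 2) ltac:(lra))).
intros e H1 H2 r Hr; specialize (H1 r Hr); rewrite Rminus_0_r in H2.
replace (U e r) with ((U e r - U e 0) + U e 0) by ring.
apply Rle_trans with (1 := Rabs_triang _ _); lra.
Qed.

Lemma fam_exp_small k : loc_small Rad (fun e r => exp (k * U e r) - 1).
Proof.
intros r0 eta Hr0 Heta.
destruct (exp_sub1_small eta Heta) as [d [Hd Hexp]].
pose proof (Rabs_pos k).
apply filter_imp with (2 := fam_U_small r0 (d / (Rabs k + 1)) Hr0
  ltac:(apply Rdiv_lt_0_compat; lra)).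
intros e He r Hr; apply Hexp; rewrite Rabs_mult.
apply Rle_trans with ((Rabs k + 1) * (d / (Rabs k + 1))).
- apply Rmult_le_compat; try apply Rabs_pos; [lra|now apply He].
- right; field; lra.
Qed.

Lemma fam_expq_bound e r : 0 < e < 1 -> 0 <= r <= Rad ->
  Rabs (exp (- q * U e r) - 1) <= Kq' + 1.
Proof.
intros [He _] Hr; pose proof (sol_expq_le _ _ _ _ _ _ _ _ _ _ _ _ _ _ HD He (HS e He) r Hr) as K.
fold Kq' in K.
pose proof (exp_pos (- q * U e r)); apply Rabs_le; lra.
Qed.

Lemma fam_expq_lim h : cts h ->
  filterlim (fun e => RInt (fun r => h r * (exp (- q * U e r) - 1)) 0 Rad)
    (at_right 0) (locally 0).
Proof.
intros Hh; apply (loc_small_lim_bounded Rad (fun e r => exp (- q * U e r) - 1)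
  h (Kq' + 1)); auto.
- intros e He; pose proof (fam_U_cts e ltac:(lra)); cts.
- apply fam_expq_bound.
- apply fam_exp_small.
Qed.

(** The exponential in the denominator of [b] is bounded uniformly in [e], so that denominator
    converges to [V]. *)
Lemma fam_b_lim : filterlim b (at_right 0) (locally B).
Proof.
set (V := Rad ^ S n / INR (S n)).
assert (HV : 0 < V) by (use vol_pos HD HD HD).
pose proof (fam_expq_lim (fun r => r ^ n) ltac:(cts)) as E.
pose proof (lim_plus _ _ _ _ (lim_const V) E) as E2.
pose proof (lim_cts _ Rinv _ (continuous_Rinv (V + 0) ltac:(lra)) E2) as E3.
pose proof (lim_mult _ _ _ _ (lim_const (V * B)) E3) as E4.
replace (V * B * / (V + 0)) with B in E4 by (field; lra).
revert E4; apply lim_ext_pos; intros e He.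
pose proof (fam_U_cts e He); pose proof (fam_b e He).
pose proof (sol_b _ _ _ _ _ _ _ _ _ _ _ _ (HS e He)) as Eb; fold V in Eb.
set (I := RInt (fun r => r ^ n * exp (- q * U e r)) 0 Rad) in *.
replace (V + RInt (fun r => r ^ n * (exp (- q * U e r) - 1)) 0 Rad) with I.
- rewrite <- Eb; field; intros Z; rewrite Z, Rmult_0_r in Eb; nra.
- unfold V; rewrite <- RInt_pow0, <- RInt_cts_plus by cts.
  apply (RInt_ext (V := R_CompleteNormedModule)); intros; simpl; ring.
Qed.

Lemma fam_exp0_lim k : filterlim (fun e => exp (k * U e 0)) (at_right 0) (locally 1).
Proof.
assert (C : cts (fun y => exp (k * y))) by cts.
pose proof (lim_cts _ (fun y => exp (k * y)) 0 (C 0) fam_U0_lim) as E.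
cbv beta in E; rewrite Rmult_0_r, exp_0 in E; exact E.
Qed.

Lemma fam_F0_lim : filterlim (fun e => F e (U e 0)) (at_right 0) (locally 0).
Proof.
apply lim_at_right; intros eta Heta.
apply filter_imp with (2 := fam_F_small 0 eta ltac:(lra) Heta).
intros e He; rewrite Rminus_0_r; apply He; lra.
Qed.

(** The relation [a e * exp (p * U e 0) = F e (U e 0) + b e * exp (- q * U e 0)] is solved for
    [a e]; every other term has a known limit. *)
Lemma fam_a_lim : filterlim a (at_right 0) (locally B).
Proof.
pose proof (lim_mult _ _ _ _ (lim_plus _ _ _ _ fam_F0_lim
  (lim_mult _ _ _ _ fam_b_lim (fam_exp0_lim (- q)))) (fam_exp0_lim (- p))) as E.
replace ((0 + B * 1) * 1) with B in E by ring.
revert E; apply lim_ext_pos; intros e He; unfold F.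
replace (- p * U e 0) with (- (p * U e 0)) by ring; rewrite exp_Ropp.
field; apply Rgt_not_eq, exp_pos.
Qed.

Lemma fam_F_dirac h : cts h ->
  filterlim (fun e => RInt (fun r => h r * F e (U e r)) 0 Rad) (at_right 0)
    (locally (c * h Rad)).
Proof.
intros Hh; destruct fam_F_int as [K HK].
apply (dirac_lim Rad (fun e r => F e (U e r)) (fun r => r ^ n) c K); auto.
- cts.
- apply pow_nonzero; lra.
- intros e He; apply fam_F_cts; lra.
- intros e r He Hr; apply fam_F_nonneg; lra.
- apply fam_F_small.
- apply lim_ext_pos with (2 := lim_const (c * Rad ^ n)).
  intros e He; symmetry; now apply fam_F_mass.
Qed.

(** Solving the definition of [F] gives [a * (exp (p U) - 1) = F + b * (exp (- q U) - 1) + (b - a)],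
    and only [F] contributes in the limit. *)
Lemma fam_expp_dirac h : cts h ->
  filterlim (fun e => RInt (fun r => h r * (exp (p * U e r) - 1)) 0 Rad)
    (at_right 0) (locally (c / B * h Rad)).
Proof.
intros Hh.
pose proof (lim_cts _ Rinv _ (continuous_Rinv B ltac:(lra)) fam_a_lim) as Ia.
pose proof (lim_plus _ _ _ _ fam_b_lim
  (lim_mult _ _ _ _ (lim_const (-1)) fam_a_lim)) as Iab.
pose proof (lim_mult _ _ _ _ Ia (lim_plus _ _ _ _ (fam_F_dirac h Hh)
  (lim_plus _ _ _ _ (lim_mult _ _ _ _ fam_b_lim (fam_expq_lim h Hh))
    (lim_mult _ _ _ _ Iab (lim_const (RInt h 0 Rad)))))) as E.
match type of E with filterlim _ _ (locally ?l) =>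
  replace l with (c / B * h Rad) in E by (field; lra) end.
revert E; apply lim_ext_pos; intros e He.
pose proof (fam_U_cts e He); pose proof (fam_F_cts e He); pose proof (fam_a e He).
rewrite <- !RInt_cts_scal by cts.
rewrite <- !RInt_cts_plus by cts.
rewrite <- RInt_cts_scal by cts.
apply (RInt_ext (V := R_CompleteNormedModule)); intros; unfold F; simpl; field; lra.
Qed.

Lemma fam_Q_nonneg e r : 0 < e -> 0 <= r <= Rad -> 0 <= Q e r.
Proof.
intros He Hr.
exact (Q_nonneg _ _ _ _ _ _ _ _ _ _ _ _ _ _ HD He (HS e He) 0 r (Rle_refl 0) (proj1 Hr) (proj2 Hr)).
Qed.

Lemma fam_Q_mono e x y : 0 < e -> 0 <= x -> x <= y -> y <= Rad -> Q e x <= Q e y.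
Proof.
intros He Hx Hxy Hy; pose proof (Q_nonneg _ _ _ _ _ _ _ _ _ _ _ _ _ _ HD He (HS e He) x y Hx Hxy Hy) as K.
unfold Q; lra.
Qed.

Lemma fam_Q_le e r : 0 < e -> 0 <= r <= Rad ->
  Q e r <= (A / p + A * Kq' / q) * exp (p * U e r).
Proof. intros He Hr; exact (sol_Q_le _ _ _ _ _ _ _ _ _ _ _ _ _ _ HD He (HS e He) r Hr). Qed.

Lemma KQ_pos : 0 < A / p + A * Kq' / q.
Proof.
pose proof Kq_pos; apply Rplus_lt_0_compat; apply Rdiv_lt_0_compat; nra.
Qed.

Lemma fam_Q_small : loc_small Rad Q.
Proof.
intros r0 eta Hr0 Heta.
set (k := 2 * (A / p + B / q)).
assert (0 < A / p) by (apply Rdiv_lt_0_compat; lra).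
assert (0 < B / q) by (apply Rdiv_lt_0_compat; lra).
assert (Hk : 0 < k) by (unfold k; lra).
assert (Hek : 0 < eta / k) by now apply Rdiv_lt_0_compat.
apply (at_right_and _ _ _ (at_right_lt 1 Rlt_0_1)
  (filter_and _ _ (fam_exp_small p r0 (eta / k) Hr0 Hek)
     (fam_exp_small (- q) r0 (eta / k) Hr0 Hek))).
intros e [He _] [E1 E2] r Hr.
rewrite Rabs_pos_eq by (apply fam_Q_nonneg; lra).
pose proof (E1 r Hr) as P1; pose proof (E2 r Hr) as P2.
pose proof (E1 0 ltac:(lra)) as P3; pose proof (E2 0 ltac:(lra)) as P4.
apply Rabs_le_between in P1, P2, P3, P4.
pose proof (fam_a e He) as Ha; pose proof (fam_b e He) as Hb.
assert (Hip : 0 < / p) by now apply Rinv_0_lt_compat.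
assert (Hiq : 0 < / q) by now apply Rinv_0_lt_compat.
apply Rle_trans with (A / p * (2 * (eta / k)) + B / q * (2 * (eta / k))).
- replace (Q e r) with (a e / p * (exp (p * U e r) - exp (p * U e 0))
    + b e / q * (exp (- q * U e r) - exp (- q * U e 0))) by (unfold Q; ring).
  assert (Ap : 0 < a e / p <= A / p) by (unfold Rdiv; split; nra).
  assert (Bp : 0 < b e / q <= B / q) by (unfold Rdiv; split; nra).
  apply Rplus_le_compat.
  + apply Rle_trans with (a e / p * (2 * (eta / k))).
    * apply Rmult_le_compat_l; lra.
    * apply Rmult_le_compat_r; lra.
  + apply Rle_trans with (b e / q * (2 * (eta / k))).
    * apply Rmult_le_compat_l; lra.
    * apply Rmult_le_compat_r; lra.
- right; unfold k; field; repeat split; try lra; nra.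
Qed.

Lemma fam_Q_int : exists K, forall e, 0 < e < 1 -> RInt (Q e) 0 Rad <= K.
Proof.
destruct fam_expp_int as [K HK].
exists ((A / p + A * Kq' / q) * K).
intros e He; pose proof (fam_U_cts e ltac:(lra)); pose proof (fam_Q_cts e ltac:(lra)).
pose proof KQ_pos.
apply Rle_trans with (RInt (fun r => (A / p + A * Kq' / q) * exp (p * U e r)) 0 Rad).
- apply RInt_cts_le; [lra|auto|apply cts_mult; [apply cts_const|cts]|].
  intros r Hr; apply fam_Q_le; lra.
- rewrite (RInt_cts_scal (fun r => exp (p * U e r))) by cts.
  apply Rmult_le_compat_l; [lra|now apply HK].
Qed.

(** Only the growing exponential carries mass, namely [c / B]; the limit [B] of [a] cancels this
    denominator and [c / p] remains. *)
Lemma fam_Q_lim : filterlim (fun e => RInt (Q e) 0 Rad) (at_right 0) (locally (c / p)).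
Proof.
pose proof (lim_mult _ _ _ _ (lim_const (-1)) (fam_exp0_lim p)) as P0.
pose proof (lim_mult _ _ _ _ (lim_const (-1)) (fam_exp0_lim (- q))) as Q0.
pose proof (lim_mult _ _ _ _ (lim_mult _ _ _ _ fam_a_lim (lim_const (/ p)))
  (lim_plus _ _ _ _ (fam_expp_dirac (fun _ => 1) ltac:(cts))
    (lim_mult _ _ _ _ (lim_plus _ _ _ _ (lim_const 1) P0) (lim_const Rad)))) as E1.
pose proof (lim_mult _ _ _ _ (lim_mult _ _ _ _ fam_b_lim (lim_const (/ q)))
  (lim_plus _ _ _ _ (fam_expq_lim (fun _ => 1) ltac:(cts))
    (lim_mult _ _ _ _ (lim_plus _ _ _ _ (lim_const 1) Q0) (lim_const Rad)))) as E2.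
pose proof (lim_plus _ _ _ _ E1 E2) as E; cbv beta in E.
assert (El : forall x : R, B * / p * (x / B * 1 + (1 + -1 * 1) * Rad)
  + B * / q * (0 + (1 + -1 * 1) * Rad) = x / p) by (intros; field; lra).
rewrite El in E.
revert E; apply lim_ext_pos; intros e He.
pose proof (fam_U_cts e He).
(* The constants multiplied by [Rad] become integrals of constants, so that both sides merge into
   one integral. *)
replace Rad with (Rad - 0) at 2 4 by ring.
rewrite <- !RInt_cts_const.
rewrite <- !RInt_cts_plus by cts.
rewrite <- !RInt_cts_scal by cts.
rewrite <- !RInt_cts_plus by cts.
apply (RInt_ext (V := R_CompleteNormedModule)); intros; unfold Q; simpl; field; lra.
Qed.

Lemma fam_dU2_small : loc_small Rad (fun e r => (e * dU e r) ^ 2).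
Proof.
assert (HK : 0 < K0 gm gM).
{ pose proof (Hgb 0); apply Rdiv_lt_0_compat; [lra|now apply pow_lt]. }
intros r0 eta Hr0 Heta.
apply (at_right_and _ _ _ (at_right_lt 1 Rlt_0_1)
  (fam_Q_small r0 (eta / K0 gm gM) Hr0 ltac:(now apply Rdiv_lt_0_compat))).
intros e [He _] HQ r Hr; specialize (HQ r Hr).
rewrite Rabs_pos_eq in HQ by (apply fam_Q_nonneg; lra).
rewrite Rabs_pos_eq by apply pow2_ge_0.
apply Rle_trans with (K0 gm gM * Q e r).
- use sol_du_Q HD He (HS e He); lra.
- apply Rle_trans with (K0 gm gM * (eta / K0 gm gM));
    [apply Rmult_le_compat_l; lra|right; field; lra].
Qed.

Lemma fam_dU2_int : exists K, forall e, 0 < e < 1 ->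
  RInt (fun r => (e * dU e r) ^ 2) 0 Rad <= K.
Proof.
assert (HK : 0 < K0 gm gM).
{ pose proof (Hgb 0); apply Rdiv_lt_0_compat; [lra|now apply pow_lt]. }
destruct fam_Q_int as [K HQ]; exists (K0 gm gM * K); intros e He1.
assert (He : 0 < e) by lra.
pose proof (fam_dU_cts e He); pose proof (fam_Q_cts e He).
apply Rle_trans with (RInt (fun r => K0 gm gM * Q e r) 0 Rad).
- apply RInt_cts_le; [lra|cts|cts|].
  intros r Hr; use sol_du_Q HD He (HS e He); lra.
- rewrite RInt_cts_scal by cts.
  apply Rmult_le_compat_l; [lra|now apply HQ].
Qed.

(** * Energy comparison and the limit of the squared derivative *)

Let w := fun r => r ^ n * r ^ n * g r.
Let X := fun e r => e ^ 2 * (r ^ n * g r * dU e r) ^ 2 / 2.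

Lemma w_cts : cts w.
Proof. unfold w; cts. Qed.

Lemma fam_energy e x y k eta : 0 < e -> 0 <= x -> x <= y -> y <= Rad ->
  (forall s, x < s < y -> Rabs (w s - k) <= eta) ->
  Rabs ((X e y - k * Q e y) - (X e x - k * Q e x)) <= eta * (Q e y - Q e x).
Proof.
intros He Hx Hxy Hy Hw.
pose proof (energy _ _ _ _ _ _ _ _ _ _ _ _ _ _ HD He (HS e He) x y k eta
  Hx Hxy Hy Hw) as E.
match type of E with Rabs ?l <= eta * ?r =>
  replace ((X e y - k * Q e y) - (X e x - k * Q e x)) with l
    by (unfold X, Q; ring);
  replace (Q e y - Q e x) with r by (unfold Q; ring) end.
exact E.
Qed.

Lemma fam_X0 e k : 0 < e -> X e 0 - k * Q e 0 = 0.
Proof.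
intros He; unfold X, Q.
rewrite (sol_left _ _ _ _ _ _ _ _ _ _ _ _ (HS e He)); field; lra.
Qed.

(** The weight differs from its value at [Rad] by at most twice its supremum. This crude error is
    enough wherever [Q] is small. *)
Lemma fam_energy_crude : exists W, 0 < W /\ forall e r, 0 < e -> 0 <= r <= Rad ->
  Rabs (X e r - w Rad * Q e r) <= W * Q e r.
Proof.
destruct (cts_bounded w 0 Rad ltac:(lra) w_cts) as [W [HW Hb]].
exists (2 * W); split; [lra|]; intros e r He Hr.
assert (E := fam_energy e 0 r (w Rad) (2 * W) He ltac:(lra) ltac:(lra) ltac:(lra)).
rewrite fam_X0, Rminus_0_r in E by auto.
replace (Q e r) with (Q e r - Q e 0) at 2 by (unfold Q; ring).
apply E; intros s Hs.
pose proof (Hb s ltac:(lra)) as H1; pose proof (Hb Rad ltac:(lra)) as H2.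
apply Rabs_le_between in H1, H2; apply Rabs_le; lra.
Qed.

(** Beyond [r0] the weight is within [d] of [w Rad], so the energy estimate started at [r0] costs
    only [d * Q]; up to [r0] the crude bound is uniform because [Q e r0 <= MQ]. *)
Lemma fam_energy_dom d : 0 < d -> exists M, forall e r, 0 < e < 1 ->
  0 <= r <= Rad -> Rabs (X e r - w Rad * Q e r) <= M + d * Q e r.
Proof.
intros Hd.
destruct fam_energy_crude as [W [HW Hcrude]].
destruct (cts_left_close w Rad d w_cts Hd) as [t0 [Ht0 Hc]].
set (t := Rmin Rad t0).
assert (Ht : 0 < t) by (apply Rmin_glb_lt; lra).
assert (t <= Rad) by apply Rmin_l. assert (t <= t0) by apply Rmin_r.
set (r0 := Rad - t).
assert (Hr0 : 0 <= r0 < Rad) by (unfold r0; lra).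
set (MQ := (A / p + A * Kq' / q) * ((KF n Rad A B r0 + B * Kq') / B)).
exists (W * MQ); intros e r [He He1] Hr.
assert (HQ0 : Q e r0 <= MQ).
{ apply Rle_trans with (1 := fam_Q_le e r0 He ltac:(lra)).
  apply Rmult_le_compat_l; [left; exact KQ_pos|].
  use sol_exp_le HD He (HS e He); lra. }
pose proof (fam_Q_nonneg e r He Hr).
pose proof (fam_Q_nonneg e r0 He ltac:(lra)).
destruct (Rle_dec r r0) as [Hle|Hgt].
- apply Rle_trans with (1 := Hcrude e r He Hr).
  pose proof (fam_Q_mono e r r0 He ltac:(lra) Hle ltac:(lra)); nra.
- assert (E := fam_energy e r0 r (w Rad) d He ltac:(lra) ltac:(lra) ltac:(lra)
    ltac:(intros s Hs; apply Hc; unfold r0 in *; lra)).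
  pose proof (Hcrude e r0 He ltac:(lra)) as E0.
  replace (X e r - w Rad * Q e r) with
    ((X e r - w Rad * Q e r - (X e r0 - w Rad * Q e r0))
     + (X e r0 - w Rad * Q e r0)) by ring.
  apply Rle_trans with (1 := Rabs_triang _ _); nra.
Qed.

(** The difference [X e - w Rad * Q e] is locally small and dominated by a constant plus small
    multiples of [Q], so [loc_small_lim] applies with [Q] as the dominating family. *)
Lemma fam_energy_lim :
  filterlim (fun e => RInt (X e) 0 Rad) (at_right 0) (locally (w Rad * (c / p))).
Proof.
destruct fam_Q_int as [K HK].
assert (CX : forall e, 0 < e -> cts (X e)).
{ intros e He; pose proof (fam_dU_cts e He); unfold X; cts. }
assert (E : filterlim (fun e => RInt (fun r => 1 * (X e r - w Rad * Q e r)) 0 Rad)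
  (at_right 0) (locally 0)).
{ apply (loc_small_lim Rad (fun e r => X e r - w Rad * Q e r) Q (fun _ => 1) K);
    auto.
  - cts.
  - intros e He; pose proof (CX e ltac:(lra)); pose proof (fam_Q_cts e ltac:(lra)).
    cts.
  - intros e He; apply fam_Q_cts; lra.
  - intros e r He Hr; apply fam_Q_nonneg; lra.
  - apply fam_energy_dom.
  - destruct fam_energy_crude as [W [HW Hcrude]].
    intros r0 eta Hr0 Heta.
    apply (at_right_and _ _ _ (at_right_lt 1 Rlt_0_1)
      (fam_Q_small r0 (eta / W) Hr0 ltac:(now apply Rdiv_lt_0_compat))).
    intros e [He _] HQ r Hr; specialize (HQ r Hr).
    rewrite Rabs_pos_eq in HQ by (apply fam_Q_nonneg; lra).
    apply Rle_trans with (1 := Hcrude e r He ltac:(lra)).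
    apply Rle_trans with (W * (eta / W)); [apply Rmult_le_compat_l; lra|].
    right; field; lra. }
pose proof (lim_plus _ _ _ _ E (lim_mult _ _ _ _ (lim_const (w Rad)) fam_Q_lim)) as E2.
rewrite Rplus_0_l in E2; revert E2; apply lim_ext_pos; intros e He.
pose proof (CX e He); pose proof (fam_Q_cts e He).
rewrite <- RInt_cts_scal by cts.
rewrite <- RInt_cts_plus by cts.
apply (RInt_ext (V := R_CompleteNormedModule)); intros; simpl; ring.
Qed.

(** Tested against [w * g], the integrand is exactly [2 * X], whose integral has a known limit. *)
Lemma fam_dU2_dirac h : cts h ->
  filterlim (fun e => RInt (fun r => h r * (e * dU e r) ^ 2) 0 Rad)
    (at_right 0) (locally (2 * c / (p * g Rad) * h Rad)).
Proof.
intros Hh; destruct fam_dU2_int as [K HK].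
pose proof (Hgb Rad) as HgR.
assert (HRn : 0 < Rad ^ n) by now apply pow_lt.
apply (dirac_lim Rad (fun e r => (e * dU e r) ^ 2) (fun r => w r * g r)
  (2 * c / (p * g Rad)) K); auto.
- pose proof w_cts; cts.
- apply Rgt_not_eq; unfold w; repeat apply Rmult_lt_0_compat; lra.
- intros e He; pose proof (fam_dU_cts e ltac:(lra)); cts.
- intros; apply pow2_ge_0.
- apply fam_dU2_small.
- pose proof (lim_mult _ _ _ _ (lim_const 2) fam_energy_lim) as E.
  replace (2 * c / (p * g Rad) * (w Rad * g Rad)) with (2 * (w Rad * (c / p)))
    by (generalize (w Rad), c; intros; field; lra).
  revert E; apply lim_ext_pos; intros e He.
  pose proof (fam_dU_cts e He).
  rewrite <- RInt_cts_scal by (unfold X; cts).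
  apply (RInt_ext (V := R_CompleteNormedModule)); intros; unfold X, w; simpl; field.
Qed.

Lemma fam_expq_Lconv theta : 0 < theta ->
  filterlim (fun e => Lnorm (fun r => exp (- q * U e r) - 1) 0 Rad theta)
    (at_right 0) (locally 0).
Proof.
intros Ht.
assert (E : filterlim (fun e => RInt (fun r =>
   1 * powp (Rabs (exp (- q * U e r) - 1)) theta) 0 Rad) (at_right 0) (locally 0)).
{ apply (loc_small_lim_bounded Rad
    (fun e r => powp (Rabs (exp (- q * U e r) - 1)) theta) (fun _ => 1)
    (powp (Kq' + 1) theta)); auto.
  - cts.
  - intros e He; pose proof (fam_U_cts e ltac:(lra)).
    apply cts_powp_abs; [lra|cts].
  - intros e r He Hr; rewrite Rabs_pos_eq by apply powp_nonneg.
    apply powp_le; auto; now apply fam_expq_bound.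
  - intros r0 eta Hr0 Heta; destruct (powp_small theta eta Ht Heta) as [Hp0 E].
    apply filter_imp with (2 := fam_exp_small (- q) r0 _ Hr0 Hp0).
    intros e He r Hr; rewrite Rabs_pos_eq by apply powp_nonneg.
    rewrite <- E; apply powp_le; auto. }
pose proof (lim_cts _ (fun y => powp y (/ theta)) 0
  (cts_powp _ (Rinv_0_lt_compat _ Ht) 0) E) as E2.
cbv beta in E2; rewrite powp_0 in E2; revert E2; apply lim_ext_pos; intros e He.
unfold Lnorm; f_equal.
apply (RInt_ext (V := R_CompleteNormedModule)); intros; simpl; ring.
Qed.

(** * Convergence rates of the scaled derivative *)

(** The lower bound on [U] and [sol_exp_right] give a total increase of order [L = ln (/ e)].
    Truncating at the level [la = e * L] makes both terms of [powp_young] multiples of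
    [Rpower la theta]. *)
Lemma fam_Lnorm_le1 theta : 0 < theta <= 1 -> exists C, 0 < C /\
  forall e, 0 < e < exp (-1) ->
  Lnorm (fun r => e * dU e r) 0 Rad theta <= C * e * ln (/ e).
Proof.
intros Ht.
set (k2 := K2 n Rad gm A B p q).
assert (Hk2 : 0 < k2) by (use K2_pos HD HD HD).
set (KD := Rabs (ln k2) / p + Rabs (low A B p) + 2 / p).
assert (HKD : 0 < KD).
{ unfold KD; pose proof (Rabs_pos (ln k2)); pose proof (Rabs_pos (low A B p)).
  assert (0 <= Rabs (ln k2) / p)
    by (apply Rmult_le_pos; auto; left; now apply Rinv_0_lt_compat).
  assert (0 < 2 / p) by (apply Rdiv_lt_0_compat; lra). lra. }
exists (Rpower (Rad + KD) (/ theta)); split; [apply exp_pos|].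
intros e [He He1].
assert (Hee : e < 1).
{ apply Rlt_trans with (1 := He1); rewrite <- exp_0; apply exp_increasing; lra. }
set (L := ln (/ e)).
(* The threshold [exp (-1)] is chosen for this bound, which lets the constants in the oscillation be
   absorbed into [KD * L]. *)
assert (HL : 1 <= L).
{ unfold L; rewrite ln_Rinv by auto.
  assert (ln e < ln (exp (-1))) by (apply ln_increasing; auto).
  rewrite ln_exp in *; lra. }
set (la := e * L).
assert (Hla : 0 < la) by (apply Rmult_lt_0_compat; lra).
pose proof (fam_dU_cts e He) as HdU; pose proof (fam_U_cts e He) as HU.
assert (Hosc : U e Rad - U e 0 <= KD * L).
{ assert (H0 : - low A B p <= U e 0) by (use sol_u_ge HD He (HS e He); lra).
  assert (H1 : exp (p * U e Rad) <= k2 / e ^ 2)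
    by (use sol_exp_right HD He (HS e He); lra).
  assert (H2 : p * U e Rad <= ln k2 + 2 * L).
  { rewrite <- (ln_exp (p * U e Rad)).
    apply Rle_trans with (ln (k2 / e ^ 2)).
    - apply Rcomplements.ln_le; [apply exp_pos|auto].
    - right; unfold Rdiv, L; rewrite ln_mult; auto.
      + replace (/ e ^ 2) with (/ e * / e) by (field; lra).
        rewrite ln_mult by now apply Rinv_0_lt_compat. ring.
      + apply Rinv_0_lt_compat; now apply pow_lt. }
  assert (H3 : U e Rad <= Rabs (ln k2) / p + 2 / p * L).
  { apply Rmult_le_reg_l with p; auto.
    replace (p * (Rabs (ln k2) / p + 2 / p * L)) with (Rabs (ln k2) + 2 * L)
      by (field; lra).
    pose proof (Rle_abs (ln k2)); lra. }
  pose proof (Rle_abs (low A B p)).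
  assert (0 <= Rabs (ln k2) / p).
  { apply Rmult_le_pos; [apply Rabs_pos|left; now apply Rinv_0_lt_compat]. }
  pose proof (Rabs_pos (low A B p)).
  unfold KD; nra. }
assert (Hint : RInt (fun r => powp (Rabs (e * dU e r)) theta) 0 Rad
               <= (Rad + KD) * Rpower la theta).
{ apply Rle_trans with
    (RInt (fun r => Rpower la theta + Rpower la (theta - 1) * (e * dU e r)) 0 Rad).
  - apply RInt_cts_le; [lra| |cts|].
    + apply cts_powp_abs; [lra|cts].
    + intros r Hr.
      assert (Hd : 0 <= dU e r) by (use sol_du_nonneg HD He (HS e He); lra).
      rewrite Rabs_pos_eq by nra.
      apply powp_young; auto; nra.
  - rewrite RInt_cts_plus, RInt_cts_const, RInt_cts_scal by cts.
    assert (I : RInt (fun r => e * dU e r) 0 Rad <= KD * la).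
    { apply Rle_trans with (e * U e Rad - e * U e 0).
      - apply (RInt_le_primitive _ (fun r => e * U e r)); [lra|cts|cts|].
        intros r Hr; exists (e * dU e r); split; [|lra].
        apply (is_derive_scal (U e)).
        exact (sol_deriv _ _ _ _ _ _ _ _ _ _ _ _ (HS e He) r Hr).
      - unfold la; nra. }
    assert (Rpower la (theta - 1) * la = Rpower la theta).
    { rewrite <- (Rpower_1 la) at 2 by auto.
      rewrite <- Rpower_plus; f_equal; ring. }
    assert (0 < Rpower la (theta - 1)) by apply exp_pos.
    rewrite Rminus_0_r; nra. }
unfold Lnorm.
assert (Hti : 0 < / theta) by (apply Rinv_0_lt_compat; lra).
apply Rle_trans with (1 := powp_le _ _ _ Hti Hint).
rewrite powp_pos.
2: { apply Rmult_lt_0_compat; [lra|apply exp_pos]. }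
rewrite <- Rpower_mult_distr by (try lra; apply exp_pos).
rewrite Rpower_mult, Rinv_r, Rpower_1 by lra.
unfold la, L; right; ring.
Qed.

Lemma fam_Lnorm_gt1 theta : 1 < theta < 2 -> exists C, 0 < C /\
  forall e, 0 < e < 1 ->
  Lnorm (fun r => e * dU e r) 0 Rad theta <= C * Rpower e (2 / theta - 1).
Proof.
intros Ht.
set (k2 := K2 n Rad gm A B p q).
assert (Hk2 : 0 < k2) by (use K2_pos HD HD HD).
(* [S1] is a square root, known only to be nonnegative; adding 1 gives [Rpower] a positive base. *)
set (T := S1 gm gM A B p q + 1).
assert (HT : 0 < T) by (unfold T; assert (0 <= S1 gm gM A B p q) by apply sqrt_pos; lra).
set (k := p / 2 * (theta - 1)).
assert (Hk : 0 < k) by (unfold k; apply Rmult_lt_0_compat; lra).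
set (T' := Rpower T (theta - 1)).
assert (HT' : 0 < T') by apply exp_pos.
set (C1 := T' / k * Rpower k2 ((theta - 1) / 2)).
assert (HC1 : 0 < C1)
  by (apply Rmult_lt_0_compat; [now apply Rdiv_lt_0_compat|apply exp_pos]).
exists (Rpower C1 (/ theta)); split; [apply exp_pos|].
intros e [He He1].
pose proof (fam_dU_cts e He) as HdU; pose proof (fam_U_cts e He) as HU.
(* One factor [e * dU e r] is kept and the remaining power [theta - 1] is bounded by
   [T' * exp (k * U e r)], which gives an exact derivative. At [Rad] the exponential is of order
   [Rpower e (1 - theta)], and the [theta]-th root of the total gives the exponent
   [2 / theta - 1]. *)
assert (Hint : RInt (fun r => powp (Rabs (e * dU e r)) theta) 0 Rad
               <= C1 * Rpower e (2 - theta)).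
{ apply Rle_trans with (e * T' / k * exp (k * U e Rad) - e * T' / k * exp (k * U e 0)).
  - apply (RInt_le_primitive _ (fun r => e * T' / k * exp (k * U e r))); [lra| |cts|].
    + apply cts_powp_abs; [lra|cts].
    + intros r Hr.
      assert (Hd : 0 <= dU e r) by (use sol_du_nonneg HD He (HS e He); lra).
      assert (Hle : e * dU e r <= S1 gm gM A B p q * exp (p / 2 * U e r))
        by (use sol_du_le HD He (HS e He); lra).
      exists (e * dU e r * (T' * exp (k * U e r))); split.
      * replace (e * dU e r * (T' * exp (k * U e r)))
          with (e * T' / k * (exp (k * U e r) * (k * dU e r))) by (field; lra).
        apply is_derive_scal.
        rewrite (Rmult_comm (exp _)).
        apply (is_derive_comp exp (fun r => k * U e r)).
        -- apply is_derive_exp.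
        -- apply (is_derive_scal (U e)).
           exact (sol_deriv _ _ _ _ _ _ _ _ _ _ _ _ (HS e He) r Hr).
      * rewrite Rabs_pos_eq by nra.
        destruct (Req_dec (dU e r) 0) as [->|Hne].
        { rewrite Rmult_0_r, powp_0; lra. }
        assert (Hpos : 0 < e * dU e r) by (apply Rmult_lt_0_compat; lra).
        rewrite powp_pos by auto.
        replace theta with (1 + (theta - 1)) at 1 by ring.
        rewrite Rpower_plus, Rpower_1 by auto.
        apply Rmult_le_compat_l; [lra|].
        apply Rle_trans with (Rpower (T * exp (p / 2 * U e r)) (theta - 1)).
        -- apply Rle_Rpower_l; [lra|]; split; auto.
           pose proof (exp_pos (p / 2 * U e r)); unfold T; nra.
        -- rewrite <- Rpower_mult_distr by (auto; apply exp_pos).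
           right; unfold T'; f_equal; unfold Rpower, k; rewrite ln_exp; f_equal; ring.
  - apply Rle_trans with (e * T' / k * exp (k * U e Rad)).
    { assert (0 < e * T' / k * exp (k * U e 0)); [|lra].
      apply Rmult_lt_0_compat; [|apply exp_pos].
      apply Rdiv_lt_0_compat; auto; now apply Rmult_lt_0_compat. }
    assert (H1 : exp (p * U e Rad) <= k2 / e ^ 2)
      by (use sol_exp_right HD He (HS e He); lra).
    assert (H2 : exp (k * U e Rad) <= Rpower k2 ((theta - 1) / 2) * Rpower e (1 - theta)).
    { replace (exp (k * U e Rad)) with (Rpower (exp (p * U e Rad)) ((theta - 1) / 2)).
      2: { unfold Rpower, k; rewrite ln_exp; f_equal; field. }
      apply Rle_trans with (Rpower (k2 / e ^ 2) ((theta - 1) / 2)).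
      - apply Rle_Rpower_l; [lra|]; split; auto; apply exp_pos.
      - unfold Rdiv at 1; rewrite <- Rpower_mult_distr; auto.
        2: { apply Rinv_0_lt_compat; now apply pow_lt. }
        right; f_equal; unfold Rpower; f_equal.
        rewrite ln_Rinv by now apply pow_lt.
        rewrite ln_pow by auto; simpl INR; field. }
    apply Rle_trans with (e * T' / k * (Rpower k2 ((theta - 1) / 2) * Rpower e (1 - theta))).
    + apply Rmult_le_compat_l; auto; left.
      apply Rdiv_lt_0_compat; auto; now apply Rmult_lt_0_compat.
    + right; unfold C1.
      replace (Rpower e (2 - theta)) with (e * Rpower e (1 - theta)); [field; lra|].
      rewrite <- (Rpower_1 e) at 1 by auto.
      rewrite <- Rpower_plus; f_equal; ring. }
unfold Lnorm.
assert (Hti : 0 < / theta) by (apply Rinv_0_lt_compat; lra).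
apply Rle_trans with (1 := powp_le _ _ _ Hti Hint).
rewrite powp_pos by (apply Rmult_lt_0_compat; [auto|apply exp_pos]).
rewrite <- Rpower_mult_distr by (auto; apply exp_pos).
rewrite Rpower_mult; right; do 2 f_equal; field; lra.
Qed.

Lemma fam_Lnorm_bound theta : 0 < theta < 2 ->
  exists C, 0 < C /\ exists eps0, 0 < eps0 /\ forall eps, 0 < eps < eps0 ->
    Lnorm (fun r => eps * dU eps r) 0 Rad theta
    <= C * Rpower eps (Rmin 1 (2 / theta - 1))
         * (ln (/ eps)) ^ (if Rle_dec theta 1 then 1%nat else 0%nat).
Proof.
intros Ht; destruct (Rle_dec theta 1) as [Hle|Hgt].
- destruct (fam_Lnorm_le1 theta ltac:(lra)) as [C [HC H]].
  exists C; split; auto; exists (exp (-1)); split; [apply exp_pos|].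
  intros e He; apply Rle_trans with (1 := H e He).
  rewrite Rmin_left, Rpower_1, pow_1 by
    (first [lra | assert (2 <= 2 / theta); [|lra];
     apply Rmult_le_reg_r with theta; [lra|];
     replace (2 / theta * theta) with 2 by (field; lra); lra]).
  lra.
- destruct (fam_Lnorm_gt1 theta ltac:(lra)) as [C [HC H]].
  exists C; split; auto; exists 1; split; [lra|].
  intros e He; apply Rle_trans with (1 := H e He).
  rewrite Rmin_right, pow_O by
    (assert (2 / theta <= 2); [|lra];
     apply Rmult_le_reg_r with theta; [lra|];
     replace (2 / theta * theta) with 2 by (field; lra); lra).
  lra.
Qed.

(** Half of the exponent [m] pays for the logarithm, since [L <= 2 / m * exp (m / 2 * L)]; a bound
    of order [Rpower e (m / 2)] is left. *)
Lemma fam_dU_Lconv theta : 0 < theta < 2 ->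
  filterlim (fun e => Lnorm (fun r => e * dU e r) 0 Rad theta)
    (at_right 0) (locally 0).
Proof.
intros Ht; destruct (fam_Lnorm_bound theta Ht) as [C [HC [e0 [He0 H]]]].
set (m := Rmin 1 (2 / theta - 1)) in *.
assert (Hm : 0 < m).
{ apply Rmin_glb_lt; [lra|].
  assert (1 < 2 / theta); [|lra].
  apply Rmult_lt_reg_r with theta; [lra|].
  replace (2 / theta * theta) with 2 by (field; lra); lra. }
set (C' := C * (1 + 2 / m)).
assert (0 < 2 / m) by (apply Rdiv_lt_0_compat; lra).
assert (HC' : 0 < C') by (apply Rmult_lt_0_compat; lra).
apply lim_at_right; intros eta Heta.
destruct (powp_small (m / 2) (eta / C') ltac:(lra)
  ltac:(now apply Rdiv_lt_0_compat)) as [Hd E].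
apply (at_right_and _ _ _ (at_right_lt _ He0)
  (filter_and _ _ (at_right_lt _ Hd) (at_right_lt 1 Rlt_0_1))).
intros e He [[_ Hed] [_ He1]].
rewrite Rminus_0_r, Rabs_pos_eq by apply powp_nonneg.
apply Rle_trans with (1 := H e He).
set (L := ln (/ e)).
assert (HeL : e = exp (- L)).
{ unfold L; rewrite ln_Rinv, Ropp_involutive, exp_ln; lra. }
assert (HL : 0 < L).
{ unfold L; rewrite ln_Rinv by lra.
  pose proof (ln_increasing e 1 ltac:(lra) He1) as K; rewrite ln_1 in K; lra. }
assert (HLp : L ^ (if Rle_dec theta 1 then 1%nat else 0%nat)
              <= (1 + 2 / m) * exp (m / 2 * L)).
{ pose proof (exp_ineq1_le (m / 2 * L)) as K.
  assert (Z : 2 / m * (m / 2 * L) = L) by (field; lra).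
  assert (0 < m / 2 * L) by (apply Rmult_lt_0_compat; lra).
  destruct (Rle_dec theta 1); [rewrite pow_1|rewrite pow_O]; nra. }
apply Rle_trans with (C' * Rpower e (m / 2)).
- apply Rle_trans with (C * Rpower e m * ((1 + 2 / m) * exp (m / 2 * L))).
  + apply Rmult_le_compat_l; auto; apply Rmult_le_pos; [lra|left; apply exp_pos].
  + right; unfold C'.
    replace (Rpower e m) with (exp (- (m * L)))
      by (unfold Rpower; rewrite HeL at 1; rewrite ln_exp; f_equal; ring).
    replace (Rpower e (m / 2)) with (exp (- (m * L)) * exp (m / 2 * L)); [ring|].
    rewrite <- exp_plus; unfold Rpower; rewrite HeL at 1; rewrite ln_exp.
    f_equal; field.
- rewrite <- (powp_pos e) by lra.
  apply Rle_trans with (C' * (eta / C')).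
  + apply Rmult_le_compat_l; [lra|]; rewrite <- E; apply powp_le; lra.
  + right; field; lra.
Qed.

End Family.

(** * Return to the original problem *)

Lemma RInt_ext_R (f h : R -> R) (a b : R) : a <= b ->
  (forall x, a < x < b -> f x = h x) -> RInt f a b = RInt h a b :> R.
Proof.
intros Hab H; apply (RInt_ext (V := R_CompleteNormedModule)).
rewrite Rmin_left, Rmax_right by lra; exact H.
Qed.

Lemma Lnorm_ext (f h : R -> R) (b theta : R) : 0 <= b ->
  (forall x, 0 < x < b -> Rabs (f x) = Rabs (h x)) ->
  Lnorm f 0 b theta = Lnorm h 0 b theta.
Proof.
intros Hb H; unfold Lnorm; f_equal; apply RInt_ext_R; auto.
intros x Hx; now rewrite H.
Qed.

(** Integrals see only the open interval, where clamped and original functions agree, so a test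
    function on [[0, Rad]] may be replaced by its clamped extension. *)
Lemma weak_dirac_clamp (f k : R -> R -> R) (Rad C : R) : 0 < Rad ->
  (forall e r, 0 < e -> 0 < r < Rad -> f e r = k e r) ->
  (forall h, cts h -> filterlim (fun e => RInt (fun r => h r * k e r) 0 Rad)
     (at_right 0) (locally (C * h Rad))) ->
  weak_dirac f Rad C.
Proof.
intros HR E H h Hh.
pose proof (H _ (cont_clamp h Rad ltac:(lra) Hh)) as K; cbv beta in K.
rewrite clamp_id in K by lra.
revert K; apply lim_ext_pos; intros e He; apply RInt_ext_R; [lra|].
intros r Hr; rewrite clamp_id, E by lra; reflexivity.
Qed.

Lemma Lconv0_ext (f k : R -> R -> R) (Rad theta : R) : 0 < Rad ->
  (forall e r, 0 < e -> 0 < r < Rad -> Rabs (f e r) = Rabs (k e r)) ->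
  filterlim (fun e => Lnorm (k e) 0 Rad theta) (at_right 0) (locally 0) ->
  Lconv0 f Rad theta.
Proof.
intros HR E; apply lim_ext_pos; intros e He; symmetry; apply Lnorm_ext; [lra|].
intros r Hr; now apply E.
Qed.

Lemma sol_opp (n : nat) (Rad : R) (g : R -> R) (A B p q e : R)
  (u du : R -> R) (a b : R) : 0 < Rad -> 0 < e -> g Rad <> 0 ->
  sol n Rad g A B p q e u du a b ->
  sol n Rad g B A q p e (fun r => - u r) (fun r => - du r) b a.
Proof.
intros HR He Hg [Cu Cd Du Dv L0 LR Hm Ha Hb].
assert (Hn : INR (S n) <> 0) by (apply not_0_INR; lia).
split.
- cts.
- cts.
- intros x Hx; apply (is_derive_opp u), Du, Hx.
- intros x Hx.
  apply is_derive_ext with (fun r => - (r ^ n * g r * du r)); [intros; simpl; ring|].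
  replace (x ^ n * (b * exp (q * - u x) - a * exp (- p * - u x)) / e ^ 2)
    with (- (x ^ n * (a * exp (p * u x) - b * exp (- q * u x)) / e ^ 2)).
  + apply (is_derive_opp (fun r => r ^ n * g r * du r)), Dv, Hx.
  + replace (q * - u x) with (- q * u x) by ring.
    replace (- p * - u x) with (p * u x) by ring. field; lra.
- rewrite L0; ring.
- rewrite LR; field; repeat split; lra.
- transitivity (RInt (fun s => -1 * (s ^ n * u s)) 0 Rad).
  + apply RInt_ext_R; [lra|]; intros; ring.
  + rewrite RInt_cts_scal, Hm, Rmult_0_r by cts; reflexivity.
- rewrite <- Hb; f_equal; apply RInt_ext_R; [lra|].
  intros; do 2 f_equal; ring.
- rewrite <- Ha; f_equal; apply RInt_ext_R; [lra|].
  intros; do 2 f_equal; ring.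
Qed.

(** [Derive u] is identified with [u'] only inside the interval, which is still a neighbourhood of
    [x]. *)
Lemma Derive_n_2_is_derive (u u' : R -> R) (a b x : R) : a < x < b ->
  (forall y, a < y < b -> is_derive u y (u' y)) -> ex_derive_n u 2 x ->
  is_derive u' x (Derive_n u 2 x).
Proof.
intros Hx Hu H2.
apply is_derive_ext_loc with (Derive u).
- apply filter_imp with (2 := locally_between a b x Hx).
  intros y Hy; apply is_derive_unique; auto.
- apply (Derive_correct (Derive u) x); exact H2.
Qed.

Lemma sol_of_Nstar (n : nat) (Rad : R) (g : R -> R) (A B p q eps : R)
  (u u' : R -> R) : 0 < Rad -> 0 < eps ->
  (forall x, 0 <= x <= Rad -> ex_derive g x) ->
  (forall x, 0 <= x <= Rad -> 0 < g x) ->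
  solves_Nstar (S n) Rad g A B p q eps u u' ->
  sol n Rad (fun r => g (clamp Rad r)) A B p q eps
    (fun r => u (clamp Rad r)) (fun r => u' (clamp Rad r))
    (Rad ^ S n / INR (S n) * A / Iplus (S n) Rad p u)
    (Rad ^ S n / INR (S n) * B / Iminus (S n) Rad q u).
Proof.
intros HR He Hg Hgp [[Hd Hc] [Hinf [Heq [Hm [H0 H1]]]]].
assert (Hn : 0 < INR (S n)) by (apply lt_0_INR; lia).
assert (HV : 0 < Rad ^ S n / INR (S n))
  by (apply Rdiv_lt_0_compat; auto; now apply pow_lt).
unfold rhsN, Iplus, Iminus in *.
replace (S n - 1)%nat with n in * by lia.
assert (Cu : cts (fun r => u (clamp Rad r))).
{ apply cont_clamp; [lra|]; now apply deriv_Icc_cont with u'. }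
assert (Du : forall x, 0 < x < Rad -> is_derive u x (u' x))
  by (intros x Hx; now apply deriv_Icc_is_derive with 0 Rad).
assert (Hmc : RInt (fun s => s ^ n * u (clamp Rad s)) 0 Rad = 0).
{ etransitivity; [|exact Hm]; apply RInt_ext_R; [lra|].
  intros; rewrite clamp_id by lra; reflexivity. }
assert (HI : forall k, RInt (fun s => s ^ n * exp (k * u s)) 0 Rad
                       = RInt (fun s => s ^ n * exp (k * u (clamp Rad s))) 0 Rad :> R).
{ intros k; apply RInt_ext_R; [lra|].
  intros; rewrite clamp_id by lra; reflexivity. }
(* The nonlocal denominators are nonzero by Jensen's inequality, so the quotients defining [a] and
   [b] are genuine. *)
assert (HI0 : forall k, 0 < RInt (fun s => s ^ n * exp (k * u s)) 0 Rad).
{ intros k; rewrite HI; eapply Rlt_le_trans; [exact HV|].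
  apply mean_exp_ge; auto; lra. }
pose proof (HI0 p) as Ip; pose proof (HI0 (- q)) as Iq.
split.
- exact Cu.
- apply cont_clamp; [lra|auto].
- intros x Hx; rewrite (clamp_id Rad x) by lra; now apply is_derive_clamp, Du.
- intros x Hx; rewrite (clamp_id Rad x) by lra.
  apply is_derive_ext_loc with (fun r => r ^ n * g r * u' r).
  { apply filter_imp with (2 := locally_between 0 Rad x Hx).
    intros y Hy; rewrite !clamp_id by lra; reflexivity. }
  pose proof (Derive_n_2_is_derive u u' 0 Rad x Hx Du (Hinf 2%nat x Hx)) as D2.
  pose proof (Heq x Hx) as E; rewrite S_INR in E.
  set (d2 := Derive_n u 2 x) in *.
  set (f := _ - _).
  assert (E2 : eps ^ 2 * g x * (d2 + ((INR n + 1 - 1) / x + Derive g x / g x) * u' x) = f).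
  { rewrite E; unfold f; rewrite <- S_INR; field; repeat split; lra. }
  rewrite <- E2.
  (* The derivative of [r ^ n] comes with the truncated [pred n]; for [n = 0] the coefficient
     vanishes and both sides are 0. *)
  assert (Hpn : INR n * x ^ pred n = INR n * x ^ n / x).
  { destruct n as [|k]; simpl pred; simpl pow; [simpl INR|]; field; lra. }
  pose proof (Hg x ltac:(lra)) as Dg.
  auto_derive.
  + repeat split; auto; now exists d2.
  + change (Derive (fun y => g y) x) with (Derive g x).
    change (Derive (fun y => u' y) x) with (Derive u' x).
    replace (Derive u' x) with d2 by (symmetry; now apply is_derive_unique).
    rewrite Hpn.
    pose proof (Hgp x ltac:(lra)); field; repeat split; lra.
- rewrite clamp_id by lra; exact H0.
- rewrite clamp_id by lra; exact H1.
- exact Hmc.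
- rewrite <- HI; field; repeat split; lra.
- rewrite <- HI; field; repeat split; lra.
Qed.

Lemma data_of_clamp (Rad : R) (g : R -> R) (A B p q : R) : 0 < Rad ->
  (forall x, 0 <= x <= Rad -> ex_derive g x) ->
  (forall x, 0 <= x <= Rad -> 0 < g x) ->
  0 < B -> B < A -> 0 < p -> 0 < q ->
  exists gm gM, data Rad (fun r => g (clamp Rad r)) gm gM A B p q.
Proof.
intros HR Hg Hgp HB HA Hp Hq.
assert (Cg : forall x, 0 <= x <= Rad -> continuity_pt g x).
{ intros x Hx; apply continuity_pt_filterlim.
  apply (@ex_derive_continuous R_AbsRing R_NormedModule); auto. }
destruct (continuity_ab_min g 0 Rad ltac:(lra) Cg) as [m [Hm Im]].
destruct (continuity_ab_maj g 0 Rad ltac:(lra) Cg) as [M [HM IM]].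
exists (g m), (g M); split; auto.
- apply cont_clamp; [lra|]; intros x Hx P HP.
  apply filter_le_within, (proj1 (continuity_pt_filterlim g x) (Cg x Hx)), HP.
- intros x; pose proof (clamp_in Rad x ltac:(lra)); split; auto.
Qed.

Theorem theorem4p1 (N : nat) (Rad : R) (g : R -> R) (A B p q : R)
  (U U' : R -> R -> R) :
  (2 <= N)%nat -> 0 < Rad ->
  Cinf_Icc g 0 Rad -> (forall x, 0 <= x <= Rad -> 0 < g x) ->
  0 < A -> 0 < B -> 0 < p -> 0 < q -> A <> B ->
  (forall eps, 0 < eps -> solves_Nstar N Rad g A B p q eps (U eps) (U' eps)) ->
  weak_dirac (fun eps r => rho N Rad A B p q (U eps) r) Rad (Rad * (B - A) / INR N)
  /\
  (A < B ->
     weak_dirac (fun eps r => (eps * U' eps r) ^ 2) Rad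
       (2 * Rad * (B - A) / (q * INR N * g Rad))
     /\ weak_dirac (fun eps r => exp (- q * U eps r) - 1) Rad
       (Rad * (B - A) / (A * INR N))
     /\ (forall theta, 0 < theta ->
           Lconv0 (fun eps r => exp (p * U eps r) - 1) Rad theta))
  /\
  (B < A ->
     weak_dirac (fun eps r => (eps * U' eps r) ^ 2) Rad
       (2 * Rad * (A - B) / (p * INR N * g Rad))
     /\ weak_dirac (fun eps r => exp (p * U eps r) - 1) Rad
       (Rad * (A - B) / (B * INR N))
     /\ (forall theta, 0 < theta ->
           Lconv0 (fun eps r => exp (- q * U eps r) - 1) Rad theta))
  /\
  (forall theta, 0 < theta < 2 ->
     Lconv0 (fun eps r => eps * U' eps r) Rad theta
     /\ exists C, 0 < C /\ exists eps0, 0 < eps0 /\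
          forall eps, 0 < eps < eps0 ->
            Lnorm (fun r => eps * U' eps r) 0 Rad theta
            <= C * Rpower eps (Rmin 1 (2 / theta - 1))
                 * (ln (/ eps)) ^ (if Rle_dec theta 1 then 1%nat else 0%nat)).
Proof.
intros HN HR Hginf Hgp HA HB Hp Hq HAB HU.
destruct N as [|n]; [lia|].
assert (Hg : forall x, 0 <= x <= Rad -> ex_derive g x)
  by (intros x Hx; exact (Hginf 1%nat x Hx)).
pose proof (fun e He => sol_of_Nstar n Rad g A B p q e (U e) (U' e) HR He Hg Hgp
  (HU e He)) as HS.
set (gc := fun r => g (clamp Rad r)) in HS.
assert (HgR : gc Rad = g Rad) by (unfold gc; rewrite clamp_id by lra; reflexivity).
pose proof (Hgp Rad ltac:(lra)) as HgR0.
assert (Hn : 0 < INR (S n)) by (apply lt_0_INR; lia).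
set (a := fun e => Rad ^ S n / INR (S n) * A / Iplus (S n) Rad p (U e)).
set (b := fun e => Rad ^ S n / INR (S n) * B / Iminus (S n) Rad q (U e)).
set (u := fun e r => U e (clamp Rad r)).
set (du := fun e r => U' e (clamp Rad r)).
assert (Hrho : forall e r, 0 < e -> 0 < r < Rad ->
  rho (S n) Rad A B p q (U e) r
  = b e * exp (- q * u e r) - a e * exp (p * u e r)).
{ intros e r He Hr; unfold rho, rhsN, a, b, u, Rdiv; rewrite clamp_id by lra; ring. }
destruct (Rlt_le_dec B A) as [HBA|HBA].
- destruct (data_of_clamp Rad g A B p q HR Hg Hgp HB HBA Hp Hq) as [gm [gM HD]].
  fold gc in HD.
  split; [|split; [intros; lra|split]].
  + apply weak_dirac_clamp with (2 := Hrho); auto; intros h Hh.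
    (* Here [rho] is [- F] along the solution, hence the factor -1. *)
    pose proof (lim_mult _ _ _ _ (lim_const (-1))
      (fam_F_dirac n Rad gc gm gM A B p q u du a b HD HS h Hh)) as E.
    replace (-1 * (Rad * (A - B) / INR (S n) * h Rad))
      with (Rad * (B - A) / INR (S n) * h Rad) in E by (field; lra).
    revert E; apply lim_ext_pos; intros e He.
    pose proof (sol_cts _ _ _ _ _ _ _ _ _ _ _ _ (HS e He)) as Cu; fold (u e) in Cu.
    rewrite <- RInt_cts_scal by cts.
    apply RInt_ext_R; [lra|]; intros; ring.
  + intros _; split; [|split].
    * apply weak_dirac_clamp with (fun e r => (e * du e r) ^ 2); auto.
      { intros e r He Hr; unfold du; rewrite clamp_id by lra; reflexivity. }
      intros h Hh.
      replace (2 * Rad * (A - B) / (p * INR (S n) * g Rad))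
        with (2 * (Rad * (A - B) / INR (S n)) / (p * gc Rad))
        by (rewrite HgR; field; repeat split; lra).
      exact (fam_dU2_dirac n Rad gc gm gM A B p q u du a b HD HS h Hh).
    * apply weak_dirac_clamp with (fun e r => exp (p * u e r) - 1); auto.
      { intros e r He Hr; unfold u; rewrite clamp_id by lra; reflexivity. }
      intros h Hh.
      replace (Rad * (A - B) / (B * INR (S n)))
        with (Rad * (A - B) / INR (S n) / B) by (field; lra).
      exact (fam_expp_dirac n Rad gc gm gM A B p q u du a b HD HS h Hh).
    * intros theta Ht; apply Lconv0_ext with (fun e r => exp (- q * u e r) - 1); auto.
      { intros e r He Hr; unfold u; rewrite clamp_id by lra; reflexivity. }
      exact (fam_expq_Lconv n Rad gc gm gM A B p q u du a b HD HS theta Ht).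
  + intros theta Ht.
    assert (Ed : forall e r, 0 < e -> 0 < r < Rad ->
      Rabs (e * U' e r) = Rabs (e * du e r)).
    { intros e r He Hr; unfold du; rewrite clamp_id by lra; reflexivity. }
    split.
    * apply Lconv0_ext with (fun e r => e * du e r); auto.
      exact (fam_dU_Lconv n Rad gc gm gM A B p q u du a b HD HS theta Ht).
    * destruct (fam_Lnorm_bound n Rad gc gm gM A B p q u du a b HD HS theta Ht)
        as [C [HC [e0 [He0 H]]]].
      exists C; split; auto; exists e0; split; auto; intros e He.
      rewrite (Lnorm_ext _ (fun r => e * du e r)); [auto|lra|].
      intros r Hr; apply Ed; lra.
- assert (HAB' : A < B) by lra.
  destruct (data_of_clamp Rad g B A q p HR Hg Hgp HA HAB' Hq Hp) as [gm [gM HD]].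
  fold gc in HD.
  set (u2 := fun e r => - u e r); set (du2 := fun e r => - du e r).
  assert (HS2 : forall e, 0 < e ->
    sol n Rad gc B A q p e (u2 e) (du2 e) (b e) (a e)).
  { intros e He; apply sol_opp; auto; lra. }
  assert (E1 : forall e r, q * u2 e r = - q * u e r) by (intros; unfold u2; ring).
  assert (E2 : forall e r, - p * u2 e r = p * u e r) by (intros; unfold u2; ring).
  split; [|split; [|split; [intros; lra|]]].
  + apply weak_dirac_clamp with (2 := Hrho); auto; intros h Hh.
    (* For the reflected solution [rho] is [F] itself, because the reflection exchanges the two
       exponentials and reverses the sign. *)
    pose proof (fam_F_dirac n Rad gc gm gM B A q p u2 du2 b a HD HS2 h Hh) as E.
    revert E; apply lim_ext_pos; intros e He.
    apply RInt_ext_R; [lra|]; intros; rewrite E1, E2; ring.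
  + intros _; split; [|split].
    * apply weak_dirac_clamp with (fun e r => (e * du2 e r) ^ 2); auto.
      { intros e r He Hr; unfold du2, du; rewrite clamp_id by lra; ring. }
      intros h Hh.
      replace (2 * Rad * (B - A) / (q * INR (S n) * g Rad))
        with (2 * (Rad * (B - A) / INR (S n)) / (q * gc Rad))
        by (rewrite HgR; field; repeat split; lra).
      exact (fam_dU2_dirac n Rad gc gm gM B A q p u2 du2 b a HD HS2 h Hh).
    * apply weak_dirac_clamp with (fun e r => exp (q * u2 e r) - 1); auto.
      { intros e r He Hr; rewrite E1; unfold u; rewrite clamp_id by lra; reflexivity. }
      intros h Hh.
      replace (Rad * (B - A) / (A * INR (S n)))
        with (Rad * (B - A) / INR (S n) / A) by (field; lra).
      exact (fam_expp_dirac n Rad gc gm gM B A q p u2 du2 b a HD HS2 h Hh).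
    * intros theta Ht; apply Lconv0_ext with (fun e r => exp (- p * u2 e r) - 1); auto.
      { intros e r He Hr; rewrite E2; unfold u; rewrite clamp_id by lra; reflexivity. }
      exact (fam_expq_Lconv n Rad gc gm gM B A q p u2 du2 b a HD HS2 theta Ht).
  + intros theta Ht.
    assert (Ed : forall e r, 0 < e -> 0 < r < Rad ->
      Rabs (e * U' e r) = Rabs (e * du2 e r)).
    { intros e r He Hr; unfold du2, du; rewrite clamp_id by lra.
      rewrite <- Rabs_Ropp; f_equal; ring. }
    split.
    * apply Lconv0_ext with (fun e r => e * du2 e r); auto.
      exact (fam_dU_Lconv n Rad gc gm gM B A q p u2 du2 b a HD HS2 theta Ht).
    * destruct (fam_Lnorm_bound n Rad gc gm gM B A q p u2 du2 b a HD HS2 theta Ht)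
        as [C [HC [e0 [He0 H]]]].
      exists C; split; auto; exists e0; split; auto; intros e He.
      rewrite (Lnorm_ext _ (fun r => e * du2 e r)); [auto|lra|].
      intros r Hr; apply Ed; lra.
Qed.
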